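(* Assume the setting described in the context, where $(X_i,Y_i)_{i=1}^n$ is stationary $\beta$-mixing with coefficients $\beta(\cdot)$. Let $\alpha\in(0,1)$ and $\delta_{\mathrm{cal}}>0$. Then for $i\in I_{\mathrm{test}}$, \[\mathbb{P}[Y_i\in C_{1-\alpha}(X_i)]\ge 1-\alpha-\eta,\qquad \eta=\varepsilon_{\mathrm{cal}}+\varepsilon_{\mathrm{train}}+\delta_{\mathrm{cal}},\] where $\varepsilon_{\mathrm{train}}=\beta(i-n_{\mathrm{train}})$ and \[\varepsilon_{\mathrm{cal}}=\inf_{(a,m,r)\in F_{\mathrm{cal}}}\left\{\widetilde{\sigma}(a)\sqrt{\frac{4}{n_{\mathrm{cal}}-r+1}\log\left(\frac{4}{\delta_{\mathrm{cal}}-4(m-1)\beta(a)-\beta(r)}\right)}+\frac{1}{3m}\log\left(\frac{4}{\delta_{\mathrm{cal}}-4(m-1)\beta(a)-\beta(r)}\right)+\frac{r-1}{n_{\mathrm{cal}}}\right\},\] with $F_{\mathrm{cal}}=\{(a,m,r)\in\mathbb{N}_{>0}^3: 2ma=n_{\mathrm{cal}}-r+1,\ \delta_{\mathrm{cal}}>4(m-1)\beta(a)+\beta(r)\}$ and $\widetilde{\sigma}(a)=\sqrt{\frac14+\frac{2}{a}\sum_{j=1}^{a-1}(a-j)\beta(j)}$. Additionally, if $\widehat{s}_{\mathrm{train}}(X_*,Y_* )$ almost surely has a continuous distribution conditionally on the training data, then $|\mathbb{P}[Y_i\in C_{1-\alpha}(X_i)]-(1-\alpha)|\le\eta$.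
   Context: Let $\mathcal{X},\mathcal{Y}$ be measurable spaces. A stochastic process $\{Z_t\}_{t\in\mathbb{Z}}$ is stationary if $(Z_t,\dots,Z_{t+m})\overset{d}{=}(Z_{t+k},\dots,Z_{t+m+k})$ for all $t\in\mathbb{Z}$, $m,k\in\mathbb{N}$; its $\beta$-mixing coefficient at $a\in\mathbb{N}$ is $\beta(a)=\|\mathbb{P}_{-\infty:0,a:\infty}-\mathbb{P}_{-\infty:0}\otimes\mathbb{P}_{a:\infty}\|_{\mathrm{TV}}$, where $\mathbb{P}_{-\infty:0,a:\infty}$ is the joint law of the blocks $(Z_{-\infty:0},Z_{a:\infty})$ and $\mathbb{P}_{-\infty:0}$, $\mathbb{P}_{a:\infty}$ are the laws of the individual blocks; it is $\beta$-mixing if $\beta(a)\to0$. ''The sample $(X_i,Y_i)_{i=1}^n$ is stationary $\beta$-mixing'' means $(X_i,Y_i)=Z_i$, $i=1,\dots,n$, for such a process $\{Z_t\}$ with values in $\mathcal{X}\times\mathcal{Y}$. Let $(X_*,Y_* )$ be a random pair independent of the sample with $(X_*,Y_* )\sim(X_1,Y_1)$. Write $n=n_{\mathrm{train}}+n_{\mathrm{cal}}+n_{\mathrm{test}}$ with positive integers, $I_{\mathrm{train}}=\{1,\dots,n_{\mathrm{train}}\}$, $I_{\mathrm{cal}}=\{n_{\mathrm{train}}+1,\dots,n_{\mathrm{train}}+n_{\mathrm{cal}}\}$, $I_{\mathrm{test}}=\{n_{\mathrm{train}}+n_{\mathrm{cal}}+1,\dots,n\}$. Let $s:(\mathcal{X}\times\mathcal{Y})^{n_{\mathrm{train}}+1}\to\mathbb{R}$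 be any (measurable) function and $\widehat{s}_{\mathrm{train}}(x,y)=s((X_i,Y_i)_{i\in I_{\mathrm{train}}},(x,y))$. For $\phi\in[0,1)$, $\widehat{q}_{\phi,\mathrm{cal}}=\inf\{t\in\mathbb{R}:\frac{1}{n_{\mathrm{cal}}}\sum_{i\in I_{\mathrm{cal}}}\mathbf{1}\{\widehat{s}_{\mathrm{train}}(X_i,Y_i)\le t\}\ge\phi\}$ and $C_\phi(x)=\{y\in\mathcal{Y}:\widehat{s}_{\mathrm{train}}(x,y)\le\widehat{q}_{\phi,\mathrm{cal}}\}$. An infimum over the empty set is $+\infty$. *)

(* Defs.v *)
From HB Require Import structures.
From mathcomp Require Import all_boot all_order all_algebra.
From mathcomp Require Import all_classical all_reals all_analysis.
Import Order.TTheory GRing.Theory Num.Theory.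
Import numFieldNormedType.Exports.

Set Implicit Arguments.
Unset Strict Implicit.
Unset Printing Implicit Defensive.

Local Open Scope classical_set_scope.
Local Open Scope ring_scope.

Definition coord_gen d (T : measurableType d) : set (set (nat -> T)) :=
  \bigcup_(k in [set: nat]) preimage_set_system [set: nat -> T] (fun x => x k) measurable.

Definition seqspace d (T : measurableType d) := @g_sigma_algebraType (nat -> T) (@coord_gen d T).

Section process.
Context {d dT : measure_display} {Om : measurableType d} {T : measurableType dT}
  {R : realType}.
Variable P : probability Om R.
Variable Z : int -> Om -> T.

Definition block (t : int) (m : nat) : Om -> (m.+1).-tuple T :=
  fun w => [tuple Z (t + (i : nat)%:Z) w | i < m.+1].

Definition stationary : Prop :=
  forall (t : int) (m k : nat) (A : set ((m.+1).-tuple T)), measurable A ->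
    P (block t m @^-1` A) = P (block (t + k%:Z) m @^-1` A).

(* Z_{-oo:0} encoded as k |-> Z_{-k}, and Z_{a:oo} encoded as k |-> Z_{a+k} *)
Definition past : Om -> seqspace T := fun w k => Z (- k%:Z) w.
Definition future (a : nat) : Om -> seqspace T := fun w k => Z (a%:Z + k%:Z) w.
Definition past_future (a : nat) : Om -> (seqspace T * seqspace T)%type :=
  fun w => (past w, future a w).

Definition beta_coef (a : nat) : R :=
  fine (ereal_sup [set `| pushforward P (past_future a) A
                         - (pushforward P past \x pushforward P (future a)) A |%E
                  | A in (measurable : set (set (seqspace T * seqspace T)))]).

Definition beta_mixing : Prop := beta_coef a @[a --> \oo] --> (0 : R).

End process.

Section conformal.
Context {d dX dY : measure_display} {Om : measurableType d}
  {TX : measurableType dX} {TY : measurableType dY} {R : realType}.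
Variable Z : int -> Om -> (TX * TY)%type.
Variables (ntrain ncal : nat).
Variable s : (ntrain.+1).-tuple (TX * TY)%type -> R.

Definition train_input (w : Om) (z : TX * TY) : (ntrain.+1).-tuple (TX * TY)%type :=
  [tuple (if (i < ntrain)%N then Z ((i : nat).+1)%:Z w else z) | i < ntrain.+1].

Definition s_hat (w : Om) (z : TX * TY) : R := s (train_input w z).

Definition cal_frac (w : Om) (t : R) : R :=
  (\sum_(ntrain.+1 <= j < (ntrain + ncal).+1)
      (((s_hat w (Z j%:Z w) <= t)%R : bool) : nat)%:R) / ncal%:R.

(* \hat q_{phi,cal} (in the extended reals; inf of the empty set is +oo) *)
Definition qhat (phi : R) (w : Om) : \bar R :=
  ereal_inf [set t%:E | t in [set t : R | phi <= cal_frac w t]].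

Definition conf_set (phi : R) (w : Om) (x : TX) : set TY :=
  [set y | ((s_hat w (x, y))%:E <= qhat phi w)%E].

Definition covered (phi : R) (i : nat) : set Om :=
  [set w | conf_set phi w (Z i%:Z w).1 (Z i%:Z w).2].

End conformal.

Section bounds.
Context {R : realType}.
Variable beta : nat -> R.
Variables (ncal : nat) (delta : R).

Definition sigma_tilde (a : nat) : R :=
  Num.sqrt (1 / 4 + 2 / a%:R * \sum_(1 <= j < a) ((a - j)%:R * beta j)).

Definition F_cal : set (nat * nat * nat) :=
  [set amr | let: (a, m, r) := amr in
     [/\ (0 < a)%N, (0 < m)%N, (0 < r)%N,
         (2 * m * a + r = ncal + 1)%N &
         delta > 4 * (m%:R - 1) * beta a + beta r]].

Definition cal_term (amr : nat * nat * nat) : R :=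
  let: (a, m, r) := amr in
  let L := ln (4 / (delta - 4 * (m%:R - 1) * beta a - beta r)) in
  sigma_tilde a * Num.sqrt (4 / (ncal%:R - r%:R + 1) * L)
  + 1 / (3 * m%:R) * L + (r%:R - 1) / ncal%:R.

(* eps_cal (inf over the empty set is +oo) *)
Definition eps_cal : \bar R := ereal_inf [set (cal_term amr)%:E | amr in F_cal].

End bounds.

(* Main.v *)
(* Proof idea. Replacing the block after a gap [g] by an independent copy changes
   the probability of an event by at most [beta g]. This is used three times.
   - Among the last [2 m a] calibration points, cut into blocks of length [a],
     the block sums of every second block obey a Bernstein inequality: the
     Chernoff bound is propagated one block at a time, each step costing
     [beta a], and the variance of one block sum is at most [a * sigma_tilde a ^ 2].
   - A gap of [r] decouples these points from the training data, which may then
     be frozen, so that the empirical measure of one fixed set of points is all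
     that has to be controlled.
   - A gap of [i - ntrain] decouples the test point from the training data.
   Non-coverage says that at least [(1 - alpha) ncal] calibration scores lie
   below the test score. Up to the event that the conditional rank of the test
   score is extreme, this forces too many calibration points into the fixed set
   of points of conditional rank at most [1 - alpha - eps_cal]; ranks are
   controlled by [P (F X <= psi) <= psi]. Coverage is handled symmetrically. *)
Require Import Defs.
From HB Require Import structures.
From mathcomp Require Import all_boot all_order all_algebra.
From mathcomp Require Import all_classical all_reals all_analysis.
From mathcomp Require Import measurable_realfun.
From mathcomp Require Import ring lra zify.
Import Order.TTheory GRing.Theory Num.Theory.
Import numFieldNormedType.Exports.

Set Implicit Arguments.
Unset Strict Implicit.
Unset Printing Implicit Defensive.

Local Open Scope classical_set_scope.
Local Open Scope ring_scope.

(** * Bernstein bounds for the exponential *)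

Lemma ge0_is_derive_ge0 (R : realType) (f f' : R -> R) :
  (forall x : R, is_derive x (1 : R) f (f' x)) -> (forall x : R, 0 <= x -> 0 <= f' x) ->
  0 <= f 0 -> forall x : R, 0 <= x -> 0 <= f x.
Proof.
move=> df f'0 f0 x x0; apply: (le_trans f0).
apply: (@ger0_derive1_ndecry R f 0) => //.
- move=> y; rewrite in_itv/= andbT => y0.
  by rewrite derive1E (@derive_val _ _ _ _ _ _ _ (df y)) f'0 // ltW.
- apply/continuous_within_itvcyP; split.
    move=> y _; apply/differentiable_continuous/derivable1_diffP.
    by case: (df y).
  apply: cvg_at_right_filter.
  apply/differentiable_continuous/derivable1_diffP.
  by case: (df 0).
Qed.

Lemma expR_ge_taylor2 (R : realType) (x : R) :
  0 <= x -> 1 + x + x ^+ 2 / 2 <= expR x.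
Proof.
move=> x0; rewrite -subr_ge0.
apply: (@ge0_is_derive_ge0 R (fun x => expR x - (1 + x + x ^+ 2 / 2))
  (fun x => expR x - (1 + x))) => // [y|y y0|].
- by apply: is_derive_eq; rewrite /GRing.scale/=; field.
- by rewrite /= subr_ge0 expR_ge1Dx.
- by rewrite expR0; lra.
Qed.

(** For [x < 3], division by [6 - 2 * x] turns this into the quadratic bound on [expR x] with factor
    [1 / (2 * (1 - x / 3))]. The difference of the two sides vanishes at 0 together with its first
    two derivatives, and its third derivative is [2 * x * expR x]. *)
Lemma expR_pade_bound (R : realType) (x : R) :
  0 <= x -> (6 - 2 * x) * expR x <= x ^+ 2 + 4 * x + 6.
Proof.
move=> x0; rewrite -subr_ge0; move: x x0.
apply: (@ge0_is_derive_ge0 R _ (fun x => 2 * x + 4 - (4 - 2 * x) * expR x)).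
- by move=> y; apply: is_derive_eq; rewrite /GRing.scale/=; ring.
- apply: (@ge0_is_derive_ge0 R _ (fun x => 2 - (2 - 2 * x) * expR x)).
  + by move=> y; apply: is_derive_eq; rewrite /GRing.scale/=; ring.
  + apply: (@ge0_is_derive_ge0 R _ (fun x => 2 * x * expR x)).
    * by move=> y; apply: is_derive_eq; rewrite /GRing.scale/=; ring.
    * by move=> y y0; rewrite mulr_ge0 ?expR_ge0 //; lra.
    * by rewrite expR0; lra.
  + by rewrite expR0; lra.
- by rewrite expR0; lra.
Qed.

(** The factor [1 / (2 * (1 - u / 3))] grows with [u], so for [u >= 0] its value at [lam] dominates.
    For [u < 0] the factor [1 / 2] suffices: [(1 - u + u ^+ 2 / 2) * (1 + u + u ^+ 2 / 2) >= 1], and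
    the first of these is at most [expR (- u)]. *)
Lemma expR_bernstein (R : realType) (lam u : R) :
  0 <= lam < 3 -> u <= lam ->
  expR u <= 1 + u + u ^+ 2 / (2 * (1 - lam / 3)).
Proof.
move=> /andP[lam0 lam3] ulam.
have d0 : 0 < 2 * (1 - lam / 3) by lra.
have [u0|/ltW u0] := lerP 0 u.
- have := expR_pade_bound u0 => h.
  have d1 : 0 < 6 - 2 * u by lra.
  have : expR u <= (u ^+ 2 + 4 * u + 6) / (6 - 2 * u).
    by rewrite ler_pdivlMr // mulrC.
  move=> /le_trans; apply.
  have -> : (u ^+ 2 + 4 * u + 6) / (6 - 2 * u) = 1 + u + u ^+ 2 / (2 * (1 - u / 3)).
    field; apply/andP; split; apply/eqP; lra.
  rewrite lerD2l ler_wpM2l ?sqr_ge0 // lef_pV2 ?posrE //; lra.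
- have v0 : 0 <= - u by lra.
  have := expR_ge_taylor2 v0; rewrite expRN => h.
  have hu : expR u <= 1 + u + u ^+ 2 / 2.
    have e0 := expR_gt0 u.
    have : (1 - u + u ^+ 2 / 2) * expR u <= 1.
      rewrite -ler_pdivlMr // mul1r; apply: le_trans h; lra.
    have : 1 <= (1 - u + u ^+ 2 / 2) * (1 + u + u ^+ 2 / 2).
      have -> : (1 - u + u ^+ 2 / 2) * (1 + u + u ^+ 2 / 2) = 1 + (u ^+ 2) ^+ 2 / 4.
        by field.
      by rewrite lerDl divr_ge0 // sqr_ge0.
    move=> h1 h2; have := le_trans h2 h1.
    rewrite ler_pM2l //; have := sqr_ge0 u; lra.
  apply: (le_trans hu); rewrite lerD2l ler_wpM2l ?sqr_ge0 // lef_pV2 ?posrE //; lra.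
Qed.

(* The choice of [lam] making the Chernoff exponent exactly [- L]. *)
Lemma bernstein_exponent (R : realType) (V L : R) : 0 < V -> 0 < L ->
  exists2 lam, 0 < lam < 3 &
    V * (lam ^+ 2 / (2 * (1 - lam / 3))) - lam * (Num.sqrt (2 * V * L) + L / 3) = - L.
Proof.
move=> V0 L0; set q := Num.sqrt (2 * V * L).
have q0 : 0 < q by rewrite sqrtr_gt0 !mulr_gt0.
have qq : q ^+ 2 = 2 * V * L by rewrite sqr_sqrtr // ltW // !mulr_gt0.
have LE : L = q ^+ 2 / (2 * V) by rewrite qq; field; rewrite gt_eqF.
have h : 0 < 3 * V + q by lra.
(* The usual choice [x / (V + x / 3)], taken at [x = q] and not at the whole deviation [q + L / 3]:
   then [1 - lam / 3] is [3 * V / (3 * V + q)] and the exponent collapses to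
   [- q ^+ 2 / (2 * V)]. *)
exists (3 * q / (3 * V + q)).
  rewrite divr_gt0 ?mulr_gt0 //= ltr_pdivrMr //; lra.
rewrite LE; field.
by rewrite addrK !gt_eqF //= mulr_gt0.
Qed.

(** * Decoupling under beta-mixing *)

(** Exhausts a half-line, open or closed, or the whole line by countably many closed half-lines, so
    that continuity of a measure from below applies. *)
Lemma down_closed_cofinal (R : realType) (I : set R) : I !=set0 ->
  (forall x y, x <= y -> I y -> I x) ->
  exists t : nat -> R, [/\ {homo t : m n / (m <= n)%N >-> m <= n},
    forall n, I (t n) & forall x, I x -> exists n, x <= t n].
Proof.
move=> I0 Idown; have [ubI|nubI] := pselect (has_ubound I); last first.
  exists (fun n => n%:R); split => [m n mn|n|x Ix].
  - by rewrite ler_nat.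
  - apply: contrapT => nIn; apply: nubI; exists n%:R => x Ix.
    by rewrite leNgt; apply/negP => /ltW /Idown /(_ Ix).
  - by exists (Num.trunc x).+1; rewrite ltW // truncnS_gt.
have [Isup|nIsup] := pselect (I (sup I)).
  exists (fun=> sup I); split => // x Ix; exists 0%N.
  exact: ub_le_sup.
exists (fun n => sup I - n.+1%:R^-1); split => [m n mn|n|x Ix].
- by rewrite lerD2l lerN2 lef_pV2 ?posrE ?ltr0n // ler_nat.
- have n0 : 0 < (n.+1%:R)^-1 :> R by rewrite invr_gt0.
  have [x Ix hx] := sup_adherent n0 (conj I0 ubI).
  exact: Idown (ltW hx) Ix.
- have xs : x < sup I.
    rewrite lt_neqAle ub_le_sup // andbT; apply/eqP => xE; apply: nIsup.
    by rewrite -xE.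
  have [n hn] := @ltr_add_invr R _ _ xs.
  by exists n; rewrite lerBrDr ltW.
Qed.

(* The probability integral transform is stochastically larger than uniform. *)
Lemma probability_cdf_le d (Om : measurableType d) (R : realType)
    (P : probability Om R) (X : Om -> R) (psi : R) :
  measurable_fun setT X -> 0 <= psi ->
  (P [set w | P [set w' | (X w' <= X w)%R] <= psi%:E] <= psi%:E)%E.
Proof.
move=> mX psi0.
have mXle t : measurable [set w | X w <= t].
  by rewrite -[X in measurable X]setTI; apply: measurable_fun_le.
(* The event says that [X] lies in the down-closed set [I]. Each closed half-line ending in [I] has
   mass at most [psi], hence so has their increasing limit. *)
pose I := [set t | (P [set w | (X w <= t)%R] <= psi%:E)%E].
have Idown x y : x <= y -> I y -> I x.
  move=> xy; rewrite /I/=; apply: le_trans.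
  apply: le_measure; rewrite ?inE //.
  by move=> w /= /le_trans; apply.
have [I0|] := pselect (I !=set0); last first.
  move=> /set0P/negP/negPn/eqP I0.
  rewrite (_ : [set w | _] = set0) ?measure0 ?lee_fin//.
  by rewrite -subset0 => w hw; have : I (X w) by []; rewrite I0.
have [t [thomo It Icof]] := down_closed_cofinal I0 Idown.
rewrite (_ : [set w | _] = \bigcup_n [set w | X w <= t n]); last first.
  apply/seteqP; split => [w /= hw|w [n _] /= hw].
    by have [n hn] := Icof (X w) hw; exists n.
  exact: (Idown _ _ hw (It n)).
have h : P [set w | X w <= t n] @[n --> \oo] -->
    P (\bigcup_n [set w | X w <= t n]).
  apply: nondecreasing_cvg_mu => //; first exact: bigcupT_measurable.
  move=> m n mn; apply/subsetPset => w /= /le_trans; apply; exact: thomo.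
apply: (cvge_to_le h).
by apply: nearW => n; exact: It.
Qed.

(** * Measurable sections and independent copies *)

Lemma measurable_preimage d1 d2 (X : measurableType d1) (Y : measurableType d2)
    (f : X -> Y) (B : set Y) :
  measurable_fun setT f -> measurable B -> measurable (f @^-1` B).
Proof. by move=> mf mB; rewrite -[X in measurable X]setTI; exact: mf. Qed.

Lemma measurable_section d1 d2 (X : measurableType d1) (Y : measurableType d2)
    (B : set (X * Y)) (x : X) : measurable B -> measurable [set y | B (x, y)].
Proof.
apply: measurable_preimage.
apply/measurable_fun_pairP; split; [exact: measurable_cst|exact: measurable_id].
Qed.

Lemma measurable_preimage_snd d1 d2 d3 (X : measurableType d1)
    (Y : measurableType d2) (U : measurableType d3) (g : U -> Y) (B : set (X * Y)) :
  measurable_fun setT g -> measurable B ->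
  measurable [set x : X * U | B (x.1, g x.2)].
Proof.
move=> mg; apply: measurable_preimage.
apply/measurable_fun_pairP; split; first exact: measurable_fst.
exact: (measurableT_comp mg measurable_snd).
Qed.

Lemma measurable_preimage_pair d1 d2 d3 (X : measurableType d1)
    (Y : measurableType d2) (U : measurableType d3) (f : U -> X) (g : U -> Y)
    (B : set (X * Y)) :
  measurable_fun setT f -> measurable_fun setT g -> measurable B ->
  measurable [set u | B (f u, g u)].
Proof.
move=> mf mg; apply: measurable_preimage.
by apply/measurable_fun_pairP; split.
Qed.

Lemma measurable_fun_section d d' (X : measurableType d) (Om : measurableType d')
    (R : realType) (P : probability Om R) (B : set (X * Om)) :
  measurable B -> measurable_fun [set: X] ((fun x => P [set w | B (x, w)]) : X -> \bar R).
Proof.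
move=> mB; rewrite (_ : (fun x => _) = P \o xsection B).
  exact: measurable_fun_xsection.
apply/funext => x /=; congr (P _); apply/seteqP.
by split=> w /=; rewrite /xsection/= in_setE.
Qed.

Section independent_copy.
Context {d d1 d2 : measure_display} {Om : measurableType d}
  {U : measurableType d1} {V : measurableType d2} {R : realType}.
Variable P : probability Om R.

Lemma measurable_fun_copy (X : Om -> U) (Y : Om -> V) (B : set (U * V)) :
  measurable_fun setT X -> measurable_fun setT Y -> measurable B ->
  measurable_fun [set: Om] ((fun w => P [set w' | B (X w, Y w')]) : Om -> \bar R).
Proof.
move=> mX mY mB.
have h := measurable_fun_section P (measurable_preimage_snd mY mB).
exact: (measurableT_comp h mX).
Qed.

(** The integral is the mass of [B] under the product of the laws of [X] and [Y], so it depends on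
    these two laws alone. *)
Lemma eq_integral_copy (X X' : Om -> U) (Y Y' : Om -> V) (B : set (U * V)) :
  measurable_fun setT X -> measurable_fun setT X' -> measurable_fun setT Y ->
  (forall A, measurable A -> P (X @^-1` A) = P (X' @^-1` A)) ->
  (forall A, measurable A -> P (Y @^-1` A) = P (Y' @^-1` A)) ->
  measurable B ->
  (\int[P]_w P [set w' | B (X w, Y w')] =
   \int[P]_w P [set w' | B (X' w, Y' w')])%E.
Proof.
move=> mX mX' mY XX' YY' mB.
transitivity (\int[P]_w P [set w' | B (X' w, Y w')])%E; last first.
  by apply: eq_integral => w _; exact: (YY' _ (measurable_section (X' w) mB)).
have h := measurable_fun_section P (measurable_preimage_snd mY mB).
have E (W : Om -> U) : measurable_fun setT W ->
    (\int[P]_w P [set w' | B (W w, Y w')] =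
     \int[pushforward P W]_x P [set w' | B (x, Y w')])%E.
  move=> mW; rewrite ge0_integral_pushforward //.
rewrite !E //; apply: eq_measure_integral => A mA _; exact: XX'.
Qed.
End independent_copy.

Section mixing.
Context {d dT : measure_display} {Om : measurableType d} {T : measurableType dT}
  {R : realType}.
Variables (P : probability Om R) (Z : int -> Om -> T).
Hypothesis mZ : forall t, measurable_fun setT (Z t).

Lemma measurable_block t m : measurable_fun setT (block Z t m).
Proof.
apply/measurable_fun_tnthP => i.
rewrite (_ : _ \o _ = Z (t + (i : nat)%:Z)); first exact: mZ.
by apply/funext => w /=; rewrite tnth_mktuple.
Qed.

Lemma measurable_seqspace d' (U : measurableType d') (f : U -> seqspace T) :
  (forall k, measurable_fun setT (fun u => f u k)) -> measurable_fun setT f.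
Proof.
move=> mf; apply: (@measurability _ _ U (seqspace T) setT f (@coord_gen _ T) erefl).
move=> _ [_ [k _] [A mA <-]] <-; rewrite setTI.
have -> : f @^-1` ([set: nat -> T] `&` (fun x => x k) @^-1` A) =
    [set: U] `&` (fun u => f u k) @^-1` A.
  by rewrite !setTI.
exact: mf.
Qed.

Lemma measurable_coord k : measurable_fun setT (fun x : seqspace T => x k).
Proof.
move=> _ A mA; apply: sub_sigma_algebra.
by exists k => //; exists A.
Qed.

Lemma measurable_past : measurable_fun setT (past Z).
Proof. by apply: measurable_seqspace => k; exact: mZ. Qed.

Lemma measurable_future a : measurable_fun setT (future Z a).
Proof. by apply: measurable_seqspace => k; exact: mZ. Qed.

Lemma stationary_block : stationary P Z ->
  forall t t' m (A : set (m.+1.-tuple T)), measurable A ->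
  P (block Z t m @^-1` A) = P (block Z t' m @^-1` A).
Proof.
move=> sZ; suff h t (k : nat) m (A : set (m.+1.-tuple T)) : measurable A ->
    P (block Z t m @^-1` A) = P (block Z (t + k%:Z) m @^-1` A).
  move=> t t' m A mA; have [tt'|/ltW tt'] := lerP t t'.
    have -> : t' = t + `|t' - t|%N%:Z by lia.
    exact: h.
  have -> : t = t' + `|t' - t|%N%:Z by lia.
  by apply/esym; exact: h.
exact: sZ.
Qed.

(** The integral over an independent copy is the product measure of [A]. The supremum defining the
    coefficient is at most 2 and, by the choice [set0], at least 0; it is therefore finite and
    [fine] loses nothing. *)
Lemma beta_coef_ge (g : nat) (A : set (seqspace T * seqspace T)) : measurable A ->
  (P [set w | A (past Z w, future Z g w)] <=
   \int[P]_w P [set w' | A (past Z w, future Z g w')] + (beta_coef P Z g)%:E)%E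
  /\ 0 <= beta_coef P Z g.
Proof.
move=> mA.
have mpf : measurable_fun setT (past_future Z g).
  apply/measurable_fun_pairP; split; [exact: measurable_past|exact: measurable_future].
pose S := [set `|pushforward P (past_future Z g) A
  - (pushforward P (past Z) \x pushforward P (future Z g)) A|%E
  | A in (measurable : set (set (seqspace T * seqspace T)))].
have prodE B : measurable B ->
    ((pushforward P (past Z) \x pushforward P (future Z g)) B =
    \int[P]_w P [set w' | B (past Z w, future Z g w')])%E.
  move=> mB; rewrite /product_measure1.
  have mB' := measurable_preimage_snd (measurable_future g) mB.
  have BE x : P (future Z g @^-1` xsection B x) = P [set w | B (x, future Z g w)].
    by congr (P _); apply/seteqP; split=> w /=; rewrite /xsection/= in_setE.
  rewrite ge0_integral_pushforward //.
  - by apply: eq_integral => w _; rewrite /=/pushforward BE.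
  - exact: measurable_past.
  - have := measurable_fun_section P mB'.
    by congr measurable_fun; apply/funext => x /=; rewrite /pushforward BE.
  - by move=> x _; rewrite /= /pushforward measure_ge0.
have prod1 B : measurable B ->
    ((pushforward P (past Z) \x pushforward P (future Z g)) B <= 1)%E.
  move=> mB; rewrite prodE //.
  rewrite -[leRHS](_ : (\int[P]_w cst 1%:E w = 1)%E); last first.
    by rewrite integral_cst // mul1e; exact: probability_setT.
  apply: ge0_le_integral => //.
  - exact: (measurable_fun_copy P measurable_past (measurable_future g) mB).
  - move=> w _; apply: probability_le1.
    exact: measurable_preimage (measurable_future g) (measurable_section _ mB).
have prod0 B : measurable B ->
    (0 <= (pushforward P (past Z) \x pushforward P (future Z g)) B)%E.
  by move=> mB; rewrite prodE // integral_ge0.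
have joint1 B : measurable B -> (pushforward P (past_future Z g) B <= 1)%E.
  move=> mB; apply: probability_le1; rewrite -[X in measurable X]setTI; exact: mpf.
have S1 : ubound S (1 + 1)%E.
  move=> _ [B mB <-]; apply: (le_trans (lee_abs_sub _ _)).
  rewrite (gee0_abs (prod0 _ mB)) gee0_abs ?leeD ?prod1 ?joint1 //.
  exact: measure_ge0.
have S0 : S 0%E.
  exists set0; first exact: measurable0.
  rewrite prodE // /pushforward preimage_set0 measure0.
  rewrite integral0_eq => [|w _]; last by [].
  by rewrite sube0 abse0.
have supS : (ereal_sup S \is a fin_num).
  rewrite fin_numElt; apply/andP; split.
    by apply: (@lt_le_trans _ _ 0%E) (ereal_sup_ubound S0); exact: ltNyr.
  by apply: (le_lt_trans (ge_ereal_sup S1)); exact: ltry.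
have betaE : ((beta_coef P Z g)%:E = ereal_sup S) by rewrite fineK.
split; last by rewrite -lee_fin betaE; exact: ereal_sup_ubound.
rewrite betaE -prodE // addeC -leeBlDr.
  apply: le_trans (lee_abs _) _; apply: ereal_sup_ubound; exists A => //.
rewrite ge0_fin_numE ?prod0 //; apply: le_lt_trans (prod1 _ mA) _; exact: ltry.
Qed.

(** Stationarity moves the first block so that it ends at time 0; the two blocks are then functions
    of [past] and [future g]. The gap [g] is counted from the last index of the first block to the
    first index of the second. *)
Lemma mixing_decoupling (sZ : stationary P Z) t (p g l : nat)
    (B : set (p.+1.-tuple T * l.+1.-tuple T)) : measurable B ->
  (P [set w | B (block Z t p w, block Z (t + p%:Z + g%:Z) l w)] <=
   \int[P]_w P [set w' | B (block Z t p w, block Z (t + p%:Z + g%:Z) l w')]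
   + (beta_coef P Z g)%:E)%E.
Proof.
move=> mB.
(* [past] lists time backwards, so it is reversed to recover the block on times [- p] to 0. *)
pose u (x : seqspace T) : p.+1.-tuple T := [tuple x (p - i)%N | i < p.+1].
pose v (x : seqspace T) : l.+1.-tuple T := [tuple x i | i < l.+1].
have mu : measurable_fun setT u.
  apply/measurable_fun_tnthP => i; apply: eq_measurable_fun (measurable_coord (p - i)%N).
  by move=> x _ /=; rewrite tnth_mktuple.
have mv : measurable_fun setT v.
  apply/measurable_fun_tnthP => i; apply: eq_measurable_fun (measurable_coord i).
  by move=> x _ /=; rewrite tnth_mktuple.
have uE w : u (past Z w) = block Z (- p%:Z) p w.
  apply/eq_from_tnth => i; rewrite !tnth_mktuple /past; congr (Z _ w).
  by have := ltn_ord i; lia.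
have vE w : v (future Z g w) = block Z (- p%:Z + p%:Z + g%:Z) l w.
  by apply/eq_from_tnth => i; rewrite !tnth_mktuple /future addNr add0r.
have mB1 : measurable [set x : seqspace T * seqspace T | B (u x.1, v x.2)].
  apply: (measurable_preimage_pair _ _ mB).
    exact: (measurableT_comp mu measurable_fst).
  exact: (measurableT_comp mv measurable_snd).
have [/= + _] := beta_coef_ge g mB1.
under eq_set do rewrite uE vE.
(* Both blocks are read off one window of consecutive times, whose law is invariant under shifts. *)
have stat2 t1 t2 : P [set w | B (block Z t1 p w, block Z (t1 + p%:Z + g%:Z) l w)] =
    P [set w | B (block Z t2 p w, block Z (t2 + p%:Z + g%:Z) l w)].
  pose f (x : (p + g + l).+1.-tuple T) : p.+1.-tuple T * l.+1.-tuple T :=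
    ([tuple tnth x (inord i) | i < p.+1],
     [tuple tnth x (inord (p + g + i)) | i < l.+1]).
  have mf : measurable_fun setT f.
    apply/measurable_fun_pairP; split; apply/measurable_fun_tnthP => i.
      apply: eq_measurable_fun (measurable_tnth (inord i)).
      by move=> x _ /=; rewrite tnth_mktuple.
    apply: eq_measurable_fun (measurable_tnth (inord (p + g + i))).
    by move=> x _ /=; rewrite tnth_mktuple.
  have fE t0 w : f (block Z t0 (p + g + l) w) =
      (block Z t0 p w, block Z (t0 + p%:Z + g%:Z) l w).
    congr pair; apply/eq_from_tnth => i; rewrite !tnth_mktuple.
      by rewrite inordK //; have := ltn_ord i; lia.
    rewrite inordK; last by have := ltn_ord i; lia.
    by congr (Z _ w); lia.
  have mfB : measurable (f @^-1` B) by rewrite -[X in measurable X]setTI; exact: mf.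
  have := stationary_block sZ t1 t2 mfB.
  by congr (P _ = P _); apply/seteqP; split=> w /=; rewrite fE.
(* With independent copies each block can be shifted by its own amount. *)
have statI t1 t2 t3 t4 :
    (\int[P]_w P [set w' | B (block Z t1 p w, block Z t2 l w')] =
     \int[P]_w P [set w' | B (block Z t3 p w, block Z t4 l w')])%E.
  apply: eq_integral_copy => //; try exact: measurable_block.
    by move=> A; exact: stationary_block.
  by move=> A; exact: stationary_block.
rewrite (stat2 t (- p%:Z)) (statI t _ (- p%:Z) (- p%:Z + p%:Z + g%:Z)).
move=> /le_trans; apply; rewrite leeD2r // le_eqVlt; apply/orP; left; apply/eqP.
by apply: eq_integral => w _; under eq_set do rewrite uE vE.
Qed.

End mixing.

(** * Bernstein inequality for block sums *)

Section concentration.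
Context {d dT : measure_display} {Om : measurableType d} {T : measurableType dT}
  {R : realType}.
Variables (P : probability Om R) (Z : int -> Om -> T).
Hypothesis mZ : forall t, measurable_fun setT (Z t).
Hypothesis sZ : stationary P Z.
Variable A : set T.
Hypothesis mA : measurable A.

Local Notation beta := (beta_coef P Z).

Lemma beta_coef_ge0 g : 0 <= beta g.
Proof. by have [] := beta_coef_ge P mZ g measurable0. Qed.

Definition hits (t : int) (n : nat) (w : Om) : R :=
  \sum_(i < n) \1_A (Z (t + (i : nat)%:Z) w).

Definition spaced_hits (a : nat) (t : int) (m : nat) (w : Om) : R :=
  \sum_(j < m) hits (t + (2 * a * j)%N%:Z) a w.

Lemma measurable_hits t n : measurable_fun setT (hits t n).
Proof.
apply: measurable_sum => i.
exact: (measurableT_comp (measurable_indic mA) (mZ _)).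
Qed.

Lemma measurable_spaced_hits a t m : measurable_fun setT (spaced_hits a t m).
Proof. by apply: measurable_sum => j; exact: measurable_hits. Qed.

Lemma hits_ge0 t n w : 0 <= hits t n w.
Proof. by apply: sumr_ge0. Qed.

Lemma hits_le t n w : hits t n w <= n%:R.
Proof.
rewrite -[leRHS](_ : \sum_(i < n) 1 = n%:R :> R).
  by apply: ler_sum => i _; rewrite indicE lern1 leq_b1.
by rewrite sumr_const card_ord.
Qed.

Lemma hits_cat t m n w : hits t (m + n) w = hits t m w + hits (t + m%:Z) n w.
Proof.
rewrite /hits big_split_ord /=; congr (_ + _).
by apply: eq_bigr => i _; rewrite PoszD addrA.
Qed.

Lemma spaced_hitsS a t m w :
  spaced_hits a t m.+1 w = hits t a w + spaced_hits a (t + (2 * a)%N%:Z) m w.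
Proof.
rewrite /spaced_hits big_ord_recl muln0 addr0; congr (_ + _).
by apply: eq_bigr => j _; congr (hits _ _ _); rewrite lift0 mulnS PoszD addrA.
Qed.

(* The past block gets an idle last coordinate, so that the gap is [a] and not
   [a + 1]. *)
Lemma hits_decoupling (a m : nat) t (x : R) : (0 < m)%N ->
  (P [set w | (x <= hits t a w + spaced_hits a (t + (2 * a)%N%:Z) m w)%R] <=
   \int[P]_w P [set w' |
      (x <= hits t a w + spaced_hits a (t + (2 * a)%N%:Z) m w')%R]
   + (beta a)%:E)%E.
Proof.
move=> m0.
pose f1 (u : a.+1.-tuple T) : R := \sum_(i < a) \1_A (tnth u (inord i)).
pose f2 (u : (2 * a * m).+1.-tuple T) : R :=
  \sum_(j < m) \sum_(i < a) \1_A (tnth u (inord (2 * a * j + i))).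
have mf1 : measurable_fun setT f1.
  apply: measurable_sum => i.
  exact: (measurableT_comp (measurable_indic mA) (measurable_tnth _)).
have mf2 : measurable_fun setT f2.
  apply: measurable_sum => j; apply: measurable_sum => i.
  exact: (measurableT_comp (measurable_indic mA) (measurable_tnth _)).
have f1E w : f1 (block Z t a w) = hits t a w.
  apply: eq_bigr => i _; rewrite tnth_mktuple inordK //.
  by have := ltn_ord i; lia.
have f2E w : f2 (block Z (t + a%:Z + a%:Z) (2 * a * m) w) =
    spaced_hits a (t + (2 * a)%N%:Z) m w.
  apply: eq_bigr => j _; apply: eq_bigr => i _; rewrite tnth_mktuple inordK.
    by congr (\1_A (Z _ w)); lia.
  have := ltn_ord i; have := ltn_ord j => jm ia.
  have : (2 * a * j.+1 <= 2 * a * m)%N by rewrite leq_mul2l jm orbT.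
  by rewrite mulnS; lia.
pose B := [set u : a.+1.-tuple T * (2 * a * m).+1.-tuple T | x <= f1 u.1 + f2 u.2].
have mB : measurable B.
  rewrite -[X in measurable X]setTI; apply: measurable_fun_le => //.
  apply: measurable_funD.
    exact: (measurableT_comp mf1 measurable_fst).
  exact: (measurableT_comp mf2 measurable_snd).
have := mixing_decoupling mZ sZ t a mB; rewrite /B/=.
under eq_set do rewrite f1E f2E.
under eq_integral do under eq_set do rewrite f1E f2E.
done.
Qed.

(** One block is Markov's inequality. In the induction the first block is decoupled from the others
    at cost [beta a]; with its value [h] frozen, the induction hypothesis at level [x - h]
    contributes a factor [expR (lam * h)], whose integral supplies one more [M]. *)
Lemma spaced_hits_chernoff (a : nat) (lam M : R) :
  (forall t, \int[P]_w (expR (lam * hits t a w))%:E <= M%:E)%E ->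
  forall m t x, 0 <= lam ->
  (P [set w | (x <= spaced_hits a t m.+1 w)%R] <=
   (expR (- (lam * x)) * M ^+ m.+1 + m%:R * beta a)%:E)%E.
Proof.
move=> HM.
have M0 : 0 <= M by rewrite -lee_fin; apply: le_trans (HM 0); exact: integral_ge0.
have mE t : measurable_fun setT (fun w => (expR (lam * hits t a w))%:E).
  apply/measurable_EFinP; apply: (measurableT_comp (@measurable_expR R)).
  by apply: measurable_funM => //; exact: measurable_hits.
have HcM c t : 0 <= c ->
    (\int[P]_w (c * expR (lam * hits t a w))%:E <= (c * M)%:E)%E.
  move=> c0; under eq_integral do rewrite EFinM.
  rewrite ge0_integralZl_EFin //.
  by rewrite EFinM lee_wpmul2l // lee_fin.
move=> m; elim: m => [|m IH] t x lam0.
  rewrite expr1 mul0r addr0; apply: le_trans (HcM _ t (expR_ge0 _)).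
  have mX : measurable [set w | x <= spaced_hits a t 1 w].
    rewrite -[X in measurable X]setTI; apply: measurable_fun_le => //.
    exact: measurable_spaced_hits.
  rewrite -[X in (P X <= _)%E]setIT -integral_indic //.
  apply: ge0_le_integral => //.
  - by apply/measurable_EFinP; exact: measurable_indic.
  - under eq_fun do rewrite EFinM.
    by apply: emeasurable_funM => //; exact: measurable_cst.
  - move=> w _; rewrite lee_fin indicE -expRD.
    have [/= |_] := boolP (w \in _); last exact: expR_ge0.
    rewrite inE /= spaced_hitsS /spaced_hits big_ord0 addr0 => xh.
    rewrite -[leLHS]expR0 ler_expR addrC -mulrBr mulr_ge0 ?subr_ge0 //.
under eq_set do rewrite spaced_hitsS.
apply: (le_trans (hits_decoupling _ _ _ _)) => //.
rewrite (_ : _ + m.+1%:R * beta a = (expR (- (lam * x)) * M ^+ m.+1) * M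
  + m%:R * beta a + beta a); last by rewrite exprSr -natr1; ring.
rewrite EFinD leeD2r //.
apply: (@le_trans _ _ (\int[P]_w (((expR (- (lam * x)) * M ^+ m.+1) *
   expR (lam * hits t a w))%:E + (m%:R * beta a)%:E))%E).
  apply: ge0_le_integral => //.
  - have mB : measurable [set u : R * R | x <= u.1 + u.2].
      rewrite -[X in measurable X]setTI; apply: measurable_fun_le => //.
      exact: measurable_funD.
    exact: (measurable_fun_copy P (measurable_hits t a)
      (measurable_spaced_hits a (t + (2 * a)%N%:Z) m.+1) mB).
  - apply: emeasurable_funD => //; under eq_fun do rewrite EFinM.
    by apply: emeasurable_funM => //; exact: measurable_cst.
  - move=> w _; have := IH (t + (2 * a)%N%:Z) (x - hits t a w) lam0.
    under eq_set do rewrite lerBlDl.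
    move=> /le_trans; apply; rewrite -EFinD lee_fin lerD2r.
    by rewrite [leRHS]mulrAC -expRD mulrBr opprB addrC.
rewrite ge0_integralD //.
- by rewrite EFinD leeD ?HcM ?mulr_ge0 ?expR_ge0 ?exprn_ge0 //
    integral_cst // -[leRHS]mule1 lee_wpmul2l ?lee_fin ?mulr_ge0 ?beta_coef_ge0 // probability_le1.
- by move=> w _; rewrite lee_fin !mulr_ge0 ?expR_ge0 ?exprn_ge0.
- under eq_fun do rewrite EFinM.
  by apply: emeasurable_funM => //; exact: measurable_cst.
- by move=> w _; rewrite lee_fin mulr_ge0 ?beta_coef_ge0.
Qed.

(** * Moments of a block sum, and the resulting tail bounds *)

Let p : R := fine (P (Z 0 @^-1` A)).

Let mAZ t : measurable (Z t @^-1` A).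
Proof. exact: measurable_preimage. Qed.

Lemma prob_hit t : P (Z t @^-1` A) = p%:E.
Proof.
rewrite fineK ?fin_num_measure //.
have mA1 : measurable [set u : 1.-tuple T | A (tnth u ord0)].
  by apply: (measurable_preimage (measurable_tnth ord0)).
have := stationary_block sZ t 0 mA1.
by congr (P _ = P _); apply/seteqP; split=> w /=; rewrite tnth_mktuple addr0.
Qed.

Lemma prob_hit_ge0 : 0 <= p.
Proof. by rewrite fine_ge0. Qed.

Lemma prob_two_hits t (g : nat) :
  (P (Z t @^-1` A `&` Z (t + g%:Z) @^-1` A) <= (p ^+ 2 + beta g)%:E)%E.
Proof.
have mf : measurable_fun setT (fun u : 1.-tuple T => tnth u ord0).
  exact: measurable_tnth.
have mB : measurable [set u : 1.-tuple T * 1.-tuple T |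
    A (tnth u.1 ord0) /\ A (tnth u.2 ord0)].
  apply: measurableI.
    exact: (measurable_preimage (measurableT_comp mf measurable_fst)).
  exact: (measurable_preimage (measurableT_comp mf measurable_snd)).
have := mixing_decoupling mZ sZ t g mB.
rewrite /=; under eq_set do rewrite !tnth_mktuple !addr0.
under eq_integral do under eq_set do rewrite !tnth_mktuple !addr0.
move=> /le_trans; apply; rewrite EFinD leeD2r //.
rewrite (eq_integral (fun w => p%:E * (\1_(Z t @^-1` A) w)%:E)%E); last first.
  move=> w _; rewrite indicE.
  have [/= /set_mem Aw|/= /negP Aw] := boolP (w \in _).
    rewrite mule1 -(prob_hit (t + g%:Z)).
    by congr (P _); apply/seteqP; split=> w' //= [].
  rewrite mule0 (_ : [set _ | _] = set0) ?measure0 //.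
  by rewrite -subset0 => w' [/mem_set].
rewrite ge0_integralZl_EFin ?prob_hit_ge0 //; last first.
  by apply/measurable_EFinP; exact: measurable_indic.
by rewrite integral_indic // setIT [X in (_ * X)%E](prob_hit t) -EFinM expr2.
Qed.

Lemma hits_mean t n : (\int[P]_w (hits t n w)%:E = (n%:R * p)%:E)%E.
Proof.
rewrite /hits; under eq_integral do rewrite -sumEFin.
rewrite ge0_integral_sum //; last first.
  move=> i; apply/measurable_EFinP.
  exact: (measurableT_comp (measurable_indic mA) (mZ _)).
rewrite (eq_bigr (fun=> p%:E)).
  by rewrite sumEFin sumr_const card_ord mulr_natl.
move=> i _; rewrite -(prob_hit (t + i%:Z)) -[X in P X]setIT -integral_indic //.
Qed.

(** With truncated subtraction, [(i - j + (j - i))%N] is the distance of [i] and [j]. Enlarging the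
    square by one adds a corner [b 0] and a row and a column, each summing [b] over 1 to [n]. *)
Lemma sum_square_toeplitz (b : nat -> R) n :
  \sum_(i < n) \sum_(j < n) b (i - j + (j - i))%N =
  n%:R * b 0%N + 2 * \sum_(1 <= j < n) ((n - j)%:R * b j).
Proof.
elim: n => [|n IH]; first by rewrite big_ord0 big_geq // mul0r mulr0 addr0.
rewrite big_ord_recr /= (eq_bigr (fun i : 'I_n =>
  \sum_(j < n) b (i - j + (j - i))%N + b (n - i)%N)); last first.
  move=> i _; rewrite big_ord_recr /=; congr (_ + b _).
  by have := ltn_ord i; lia.
rewrite big_split /= IH big_ord_recr /= subnn.
have E1 : \sum_(i < n) b (n - i)%N = \sum_(1 <= j < n.+1) b j.
  rewrite big_add1 /= big_mkord (reindex_inj rev_ord_inj) /=.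
  by apply: eq_bigr => i _; congr b; have := ltn_ord i; lia.
have E2 : \sum_(i < n) b (n - i + (i - n))%N = \sum_(1 <= j < n.+1) b j.
  by rewrite -E1; apply: eq_bigr => i _; congr b; have := ltn_ord i; lia.
have E3 : \sum_(1 <= j < n.+1) ((n.+1 - j)%:R * b j) =
    \sum_(1 <= j < n) ((n - j)%:R * b j) + \sum_(1 <= j < n.+1) b j.
  case: n {IH E1 E2} => [|n]; first by rewrite !big_geq // addr0.
  rewrite !(@big_nat_recr _ _ _ n.+1 1) //= subSnn mul1r addrA -big_split /=.
  congr (_ + _); apply: eq_big_nat => j /andP[_ jn].
  by rewrite subSn 1?ltnW // -natr1; ring.
rewrite E1 E2 E3 -natr1; ring.
Qed.

(** The square is expanded over pairs of times. A diagonal pair has probability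
    [p <= p ^+ 2 + 1 / 4]; a pair at distance [k > 0] has probability at most [p ^+ 2 + beta k]. The
    excesses over [p ^+ 2] add up to [a * sigma_tilde a ^ 2]. *)
Lemma hits_second_moment t (a : nat) : (0 < a)%N ->
  (\int[P]_w (hits t a w ^+ 2)%:E <=
   (a%:R ^+ 2 * p ^+ 2 + a%:R * sigma_tilde beta a ^+ 2)%:E)%E.
Proof.
move=> a0.
have E w : (hits t a w ^+ 2)%:E = (\sum_(i < a) (\sum_(j < a)
    (\1_(Z (t + (i : nat)%:Z) @^-1` A `&` Z (t + (j : nat)%:Z) @^-1` A) w)%:E))%E.
  rewrite expr2 /hits mulr_suml -sumEFin; apply: eq_bigr => i _.
  rewrite mulr_sumr -sumEFin; apply: eq_bigr => j _; congr EFin.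
  by rewrite indicI.
under eq_integral do rewrite E.
have mI i j : measurable (Z (t + i%:Z) @^-1` A `&` Z (t + j%:Z) @^-1` A).
  exact: measurableI.
rewrite ge0_integral_sum //; last 2 first.
- move=> i; apply: emeasurable_sum => j; apply/measurable_EFinP.
  exact: measurable_indic.
- by move=> i w _; apply: sume_ge0 => j _; rewrite lee_fin.
pose b k : R := if k is 0%N then 1 / 4 else beta k.
apply: (@le_trans _ _ (\sum_(i < a) \sum_(j < a) (p ^+ 2 + b (i - j + (j - i))%N)%:E)%E).
  apply: lee_sum => i _; rewrite ge0_integral_sum //; last first.
    by move=> j; apply/measurable_EFinP; exact: measurable_indic.
  apply: lee_sum => j _; rewrite integral_indic // setIT.
  have [ij|ij] := eqVneq (i : nat) (j : nat).
    rewrite ij subnn addn0 /= setIid [X in (X <= _)%E](prob_hit _) lee_fin.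
    by have := sqr_ge0 (p - 1/2); rewrite sqrrB; lra.
  wlog ltij : i j ij / (i < j)%N.
    move=> H; have [lij|lji] := ltnP i j; first exact: H.
    rewrite setIC addnC; apply: H; first by rewrite eq_sym.
    by rewrite ltn_neqAle eq_sym ij.
  have := prob_two_hits (t + i%:Z) (j - i)%N.
  rewrite (_ : t + _ + (j - i)%N%:Z = t + j%:Z); last by lia.
  rewrite (_ : (i - j + (j - i))%N = (j - i)%N); last by lia.
  by rewrite /b; case: (j - i)%N (subn_gt0 i j) => //; rewrite ltij.
under eq_bigr do rewrite sumEFin.
rewrite sumEFin lee_fin.
under eq_bigr do rewrite big_split /= sumr_const card_ord.
rewrite big_split /= sumr_const card_ord sum_square_toeplitz /=.
rewrite (eq_big_nat _ _ (F2 := fun j => (a - j)%:R * beta j)); last first.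
  by move=> [|j].
rewrite /sigma_tilde sqr_sqrtr; last first.
  rewrite addr_ge0 // ?divr_ge0 // mulr_ge0 ?divr_ge0 // sumr_ge0 // => j _.
  by rewrite mulr_ge0 // beta_coef_ge0.
rewrite le_eqVlt; apply/orP; left; apply/eqP.
have aR : a%:R != 0 :> R by rewrite pnatr_eq0 -lt0n.
rewrite -(mulr_natl (p ^+ 2 *+ a)) -(mulr_natl (p ^+ 2)).
by move: (p ^+ 2) (a%:R : R) (\sum_(_ <= _ < _) _) aR => q x y x0; field.
Qed.

Lemma bounded_integrable (f : Om -> R) (K : R) :
  measurable_fun setT f -> (forall w, `|f w| <= K) ->
  P.-integrable setT (EFin \o f).
Proof.
move=> mf fK; apply: measurable_bounded_integrable => //.
  by rewrite ltey_eq fin_num_measure.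
exists K; split; first by rewrite num_real.
by move=> x Kx w _; apply: le_trans (fK w) (ltW Kx).
Qed.

(** The block average lies in [[0, 1]], so [lam] times its centred value is at most [lam] and
    [expR_bernstein] applies. The linear term integrates to 0, the quadratic one is controlled by
    the second moment, and [1 + x <= expR x] finishes. *)
Lemma hits_mgf t (a : nat) (lam : R) : (0 < a)%N -> 0 <= lam < 3 ->
  (\int[P]_w (expR (lam / a%:R * hits t a w))%:E <=
   (expR (lam * p + lam ^+ 2 / (2 * (1 - lam / 3)) *
      (sigma_tilde beta a ^+ 2 / a%:R)))%:E)%E.
Proof.
move=> a0 lam03; have /andP[lam0 lam3] := lam03.
have aR : 0 < a%:R :> R by rewrite ltr0n.
set v := sigma_tilde beta a ^+ 2 / a%:R.
set k := lam ^+ 2 / (2 * (1 - lam / 3)).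
have k0 : 0 <= k by rewrite divr_ge0 ?sqr_ge0 //; lra.
set h := hits t a; have mh : measurable_fun setT h := measurable_hits t a.
have h0 w : 0 <= h w := hits_ge0 t a w.
have ha w : h w <= a%:R := hits_le t a w.
have ih : P.-integrable setT (EFin \o h).
  by apply: (@bounded_integrable _ a%:R) => // w; rewrite ger0_norm.
have ih2 : P.-integrable setT (EFin \o (fun w => h w ^+ 2)).
  apply: (@bounded_integrable _ (a%:R ^+ 2)).
    exact: measurable_funX.
  by move=> w; rewrite ger0_norm ?sqr_ge0 // lerXn2r ?nnegrE.
have me : measurable_fun setT (fun w => expR (lam / a%:R * h w)).
  apply: (measurableT_comp (@measurable_expR R)).
  exact: measurable_funM.
have ie : P.-integrable setT (EFin \o (fun w => expR (lam / a%:R * h w))).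
  apply: (@bounded_integrable _ (expR lam)) => // w.
  rewrite ger0_norm ?expR_ge0 // ler_expR -[leRHS]mulr1 -mulrA ler_wpM2l //.
  by rewrite mulrC ler_pdivrMr ?mul1r.
(* Coefficients of the quadratic majorant, expanded in powers of the block sum. The sign of [c1] is
   not fixed, which is why the integrals below are those of integrable real functions. *)
pose c0 := expR (lam * p) * (1 - lam * p + k * p ^+ 2).
pose c1 := expR (lam * p) * (lam / a%:R - 2 * k * p / a%:R).
pose c2 := expR (lam * p) * (k / a%:R ^+ 2).
have ptw w : expR (lam / a%:R * h w) <= c0 + (c1 * h w + c2 * h w ^+ 2).
  rewrite (_ : lam / a%:R * h w = lam * p + lam * (h w / a%:R - p)); last first.
    have a1 : a%:R != 0 :> R by rewrite gt_eqF.
    by move: (h w) p (a%:R : R) a1 => x q z z0; field.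
  rewrite expRD; have : lam * (h w / a%:R - p) <= lam.
    rewrite -[leRHS]mulr1 ler_wpM2l // lerBlDr -[leLHS]addr0.
    by rewrite lerD ?prob_hit_ge0 // ler_pdivrMr ?mul1r.
  move=> /(expR_bernstein lam03) H.
  apply: (le_trans (ler_wpM2l (expR_ge0 _) H)).
  rewrite le_eqVlt; apply/orP; left; apply/eqP; rewrite /c0 /c1 /c2 /k.
  have l0 : 2 * (1 - lam / 3) != 0 by apply/eqP; lra.
  have a1 : a%:R != 0 :> R by rewrite gt_eqF.
  move: (h w) (a%:R : R) a1 (2 * (1 - lam / 3)) l0 p (expR _) => x z z0 y y0 q e.
  by field; rewrite y0 z0.
have Eh : \int[P]_w h w = a%:R * p by rewrite /Rintegral hits_mean.
have Eh2 : \int[P]_w (h w ^+ 2) <= a%:R ^+ 2 * p ^+ 2 + a%:R * sigma_tilde beta a ^+ 2.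
  rewrite -lee_fin /Rintegral fineK; first exact: hits_second_moment.
  exact: integrable_fin_num ih2.
rewrite -[X in (X <= _)%E]fineK; last exact: integrable_fin_num ie.
rewrite lee_fin.
have i12 : P.-integrable setT (EFin \o (fun w => c1 * h w + c2 * h w ^+ 2)).
  rewrite (_ : _ \o _ = (fun w => c1%:E * (EFin \o h) w +
     c2%:E * (EFin \o (fun w => (h w ^+ 2)%R)) w)%E) //.
  by apply: integrableD => //; apply: integrableZl.
have ic0 : P.-integrable setT (EFin \o (fun=> c0)).
  by apply: (@bounded_integrable _ `|c0|).
apply: (@le_trans _ _ (\int[P]_w (c0 + (c1 * h w + c2 * h w ^+ 2)))).
  apply: le_Rintegral => //.
  rewrite (_ : _ \o _ = ((EFin \o (fun=> c0)) \+
    (EFin \o (fun w => (c1 * h w + c2 * h w ^+ 2)%R)))%E) //.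
  exact: integrableD.
rewrite RintegralD // Rintegral_cst // RintegralD //; last 2 first.
- exact: (integrableZl measurableT c1 ih).
- exact: (integrableZl measurableT c2 ih2).
have P1 : fine (P setT) = 1 by rewrite probability_setT.
rewrite !RintegralZl // Eh [X in c0 * X]P1 mulr1.
apply: (@le_trans _ _ (expR (lam * p) * (1 + k * v))); last first.
  by rewrite expRD ler_wpM2l ?expR_ge0 // expR_ge1Dx.
apply: (@le_trans _ _ (c0 + (c1 * (a%:R * p) + c2 *
    (a%:R ^+ 2 * p ^+ 2 + a%:R * sigma_tilde beta a ^+ 2)))).
  by rewrite !lerD2l ler_wpM2l // mulr_ge0 ?expR_ge0 // divr_ge0 // sqr_ge0.
rewrite le_eqVlt; apply/orP; left; apply/eqP.
rewrite /c0 /c1 /c2 /v; have a1 : a%:R != 0 :> R by rewrite gt_eqF.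
move: (a%:R : R) a1 (k) (sigma_tilde _ _) (p) (expR _) => z z0 y x q e.
by field.
Qed.

Lemma sigma_tilde_gt0 a : 0 < sigma_tilde beta a.
Proof.
rewrite sqrtr_gt0 ltr_pwDl // mulr_ge0 ?divr_ge0 // sumr_ge0 // => j _.
by rewrite mulr_ge0 // beta_coef_ge0.
Qed.

(* The radius in [cal_term] without its last summand, for [2 m a] points. *)
Definition bernstein_radius (a m : nat) (L : R) : R :=
  sigma_tilde beta a * Num.sqrt (4 / (2 * m * a)%:R * L) + 1 / (3 * m%:R) * L.

Lemma spaced_hits_bernstein (a m : nat) t (L : R) : (0 < a)%N -> 0 < L ->
  (P [set w | ((m.+1 * a)%:R * (p + bernstein_radius a m.+1 L) <=
     spaced_hits a t m.+1 w)%R] <= (expR (- L) + m%:R * beta a)%:E)%E.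
Proof.
move=> a0 L0; set sg := sigma_tilde beta a.
have sg0 : 0 < sg := sigma_tilde_gt0 a.
have aR : 0 < a%:R :> R by rewrite ltr0n.
have mR : 0 < m.+1%:R :> R by rewrite ltr0n.
(* The variance proxy of a sum of [m.+1] block averages; with it the deviation of
   [bernstein_exponent] is [m.+1] times [bernstein_radius]. *)
pose V := m.+1%:R * (sg ^+ 2 / a%:R).
have V0 : 0 < V by rewrite mulr_gt0 // divr_gt0 // exprn_gt0.
have [lam /andP[lam0 lam3] lamE] := bernstein_exponent V0 L0.
set k := lam ^+ 2 / _ in lamE.
have lam03 : 0 <= lam < 3 by rewrite ltW.
have := @spaced_hits_chernoff a (lam / a%:R) _ (fun t => hits_mgf t a0 lam03) m t
   ((m.+1 * a)%:R * (p + bernstein_radius a m.+1 L)).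
move=> /(_ (divr_ge0 (ltW lam0) (ltW aR))) /le_trans; apply.
rewrite lee_fin lerD2r -expRM_natl -expRD ler_expR -lamE.
have -> : Num.sqrt (2 * V * L) = m.+1%:R * (sg * Num.sqrt (4 / (2 * m.+1 * a)%:R * L)).
  apply/eqP; rewrite -(eqrXn2 (n := 2)) ?sqrtr_ge0 //; last first.
    by rewrite !mulr_ge0 ?sqrtr_ge0 // ltW.
  have s1 : Num.sqrt (2 * V * L) ^+ 2 = 2 * V * L.
    by rewrite sqr_sqrtr // ltW // (mulr_gt0 _ L0) // (mulr_gt0 _ V0).
  have s2 : Num.sqrt (4 / (2 * m.+1 * a)%:R * L) ^+ 2 = 4 / (2 * m.+1 * a)%:R * L.
    by rewrite sqr_sqrtr // ltW // mulr_gt0 // divr_gt0 // ltr0n !muln_gt0 a0.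
  rewrite !exprMn s1 s2.
  have a1 : a%:R != 0 :> R by rewrite gt_eqF.
  have m1 : m.+1%:R != 0 :> R by rewrite gt_eqF.
  rewrite /V !natrM; apply/eqP.
  by move: (sg) (a%:R : R) (m.+1%:R : R) a1 m1 => x y z y0 z0; field; rewrite y0 z0.
rewrite le_eqVlt; apply/orP; left; apply/eqP.
have a1 : a%:R != 0 :> R by rewrite gt_eqF.
have m1 : m.+1%:R != 0 :> R by rewrite gt_eqF.
rewrite /bernstein_radius -/sg -/k natrM /V.
move: (a%:R : R) (m.+1%:R : R) a1 m1 (p) (sg) (k) (Num.sqrt _) => y z y0 z0 r x k' q.
by field; rewrite y0 z0.
Qed.

(** The stretch splits into two interleaved families of blocks, each with half of the points. A
    large total forces one family to be large, and the union bound doubles the failure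
    probability. *)
Lemma hits_bernstein (a m : nat) t (L : R) : (0 < a)%N -> 0 < L ->
  (P [set w | ((2 * m.+1 * a)%:R * (p + bernstein_radius a m.+1 L) <=
     hits t (2 * m.+1 * a) w)%R] <= (2 * expR (- L) + 2 * m%:R * beta a)%:E)%E.
Proof.
move=> a0 L0; set c := p + _.
have split_hits n s w : hits s (2 * n * a) w =
    spaced_hits a s n w + spaced_hits a (s + a%:Z) n w.
  rewrite /spaced_hits -big_split /=.
  elim: n => [|n IH]; first by rewrite big_ord0 /hits big_ord0.
  rewrite big_ord_recr /= -IH.
  rewrite (_ : (2 * n.+1 * a)%N = (2 * n * a + (a + a))%N); last by lia.
  rewrite !hits_cat; congr (_ + (hits _ _ _ + hits _ _ _)); lia.
have mS s : measurable [set w | (m.+1 * a)%:R * c <= spaced_hits a s m.+1 w].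
  rewrite -[X in measurable X]setTI; apply: measurable_fun_le => //.
  exact: measurable_spaced_hits.
apply: (@le_trans _ _ (P ([set w | (m.+1 * a)%:R * c <= spaced_hits a t m.+1 w] `|`
    [set w | (m.+1 * a)%:R * c <= spaced_hits a (t + a%:Z) m.+1 w]))).
  apply: le_measure; rewrite ?inE.
  - rewrite -[X in measurable X]setTI; apply: measurable_fun_le => //.
    exact: measurable_hits.
  - exact: measurableU.
  - move=> w /=; rewrite split_hits => H.
    apply/orP; rewrite -[_ || _]negbK negb_or -!ltNge; apply/negP => /andP[H1 H2].
    move: H; rewrite leNgt => /negP; apply.
    by rewrite (lt_le_trans (ltrD H1 H2)) // -mulrDl -natrD addnn -mul2n mulnA.
apply: (le_trans (measureU2 P (mS _) (mS _))).
rewrite (_ : 2 * _ + _ = (expR (- L) + m%:R * beta a) + (expR (- L) + m%:R * beta a)); last by ring.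
by rewrite EFinD leeD // spaced_hits_bernstein.
Qed.
End concentration.

(** * Calibration scores *)

Lemma confidence_budget_lt1 (R : realType) (y z delta : R) :
  0 <= y -> 0 <= z -> delta < 1 -> delta - 4 * y - z < 1.
Proof. lra. Qed.

(** Here [y] stands for [(m - 1) * beta a] and [z] for [beta r]. The left side is [(delta + z) / 2],
    and positivity of the budget gives [z < delta]. *)
Lemma confidence_budget (R : realType) (y z delta : R) :
  0 <= y -> 0 < delta - 4 * y - z ->
  2 * ((delta - 4 * y - z) / 4) + 2 * y + z <= delta.
Proof. lra. Qed.

Lemma three_summands_ge1 (R : realType) (y z t delta : R) :
  0 <= y -> 0 <= z -> 1 - delta / 4 <= t \/ 0 <= t -> 1 <= delta ->
  1 <= y + t + z + delta.
Proof. by move=> y0 z0 [] *; lra. Qed.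

Section split_conformal.
Context {d dT : measure_display} {Om : measurableType d} {T : measurableType dT}
  {R : realType}.
Variables (P : probability Om R) (Z : int -> Om -> T).
Hypothesis mZ : forall t, measurable_fun setT (Z t).
Hypothesis sZ : stationary P Z.

Local Notation beta := (beta_coef P Z).

Lemma cal_term_bernstein_radius (ncal a m r : nat) (delta : R) : (0 < r)%N ->
  (2 * m * a + r = ncal + 1)%N ->
  cal_term beta ncal delta (a, m, r) =
  bernstein_radius P Z a m (ln (4 / (delta - 4 * (m%:R - 1) * beta a - beta r)))
  + r.-1%:R / ncal%:R.
Proof.
move=> r0 E; rewrite /cal_term /bernstein_radius -subn1 natrB //.
have -> // : (2 * m * a)%:R = ncal%:R - r%:R + 1 :> R.
have : (2 * m * a + r)%:R = (ncal + 1)%:R :> R by rewrite E.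
by rewrite !natrD; lra.
Qed.

Lemma confidence_budget_bounds (a m r : nat) (delta : R) : (0 < m)%N ->
  delta > 4 * (m%:R - 1) * beta a + beta r ->
  0 < delta - 4 * (m%:R - 1) * beta a - beta r <= delta.
Proof.
move=> m0 xpos; rewrite -addrA -opprD subr_gt0 xpos /= gerDl oppr_le0.
rewrite addr_ge0 ?beta_coef_ge0 // !mulr_ge0 ?beta_coef_ge0 //.
by rewrite subr_ge0 ler1n.
Qed.

Lemma cal_term_ge0 (ncal a m r : nat) (delta : R) : delta < 1 ->
  F_cal beta ncal delta (a, m, r) -> 0 <= cal_term beta ncal delta (a, m, r).
Proof.
move=> delta1 [a0 m0 r0 E xpos]; rewrite (cal_term_bernstein_radius _ r0 E).
have /andP[x0 xd] := confidence_budget_bounds m0 xpos.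
rewrite addr_ge0 ?divr_ge0 // /bernstein_radius addr_ge0 //.
  by rewrite mulr_ge0 ?sqrtr_ge0.
rewrite mulr_ge0 ?divr_ge0 // ln_ge0 // ler_pdivlMr // mul1r.
by rewrite (le_trans xd) // (le_trans (ltW delta1)) // ler1n.
Qed.

(** Makes the coverage bounds trivial for [delta >= 1], where the logarithm [L] may be negative. In
    that case [L / (3 * m) >= L >= 1 - x / 4] by [expR (- L) = x / 4 >= 1 - L], and [x <= delta]. *)
Lemma cal_term_addl_ge1 (ncal a m r : nat) (delta : R) : 1 <= delta ->
  F_cal beta ncal delta (a, m, r) ->
  1 <= cal_term beta ncal delta (a, m, r) + delta.
Proof.
move=> delta1 [a0 m0 r0 E xpos]; rewrite (cal_term_bernstein_radius _ r0 E).
have /andP[x0 xd] := confidence_budget_bounds m0 xpos.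
set x := _ - beta r in x0 xd *; set L := ln _; rewrite /bernstein_radius.
have eL : expR (- L) = x / 4.
  by rewrite expRN lnK ?invf_div // posrE divr_gt0.
have h1 : 0 <= sigma_tilde beta a * Num.sqrt (4 / (2 * m * a)%:R * L).
  by rewrite mulr_ge0 ?sqrtr_ge0.
have h2 : 0 <= r.-1%:R / ncal%:R :> R by rewrite divr_ge0.
have h3 : 1 - delta / 4 <= 1 / (3 * m%:R) * L \/ 0 <= 1 / (3 * m%:R) * L.
  have c0 : 0 <= 1 / (3 * m%:R) :> R by rewrite divr_ge0.
  have [L0|L0] := leP 0 L; [right|left]; first by rewrite mulr_ge0.
  apply: (@le_trans _ _ L).
    have := expR_ge1Dx (- L); rewrite eL => h.
    apply: (@le_trans _ _ (1 - x / 4)); first by rewrite lerD2l lerN2 ler_pM2r.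
    by rewrite lerBlDr -lerBlDl.
  rewrite -[leLHS]mul1r; apply: ler_wnM2r; first exact: ltW.
  rewrite ler_pdivrMr ?mul1r.
    by rewrite -natrM ler1n muln_gt0.
  by rewrite mulr_gt0 // ltr0n.
exact: three_summands_ge1 h1 h2 h3 delta1.
Qed.

(** Calibration points falling in a set that may depend on the training block. The training size is
    [nt.+1], as [block Z 1 nt] has [nt.+1] entries. *)
Definition cal_hits (nt ncal : nat) (D : set (nt.+1.-tuple T * T)) (w : Om) : R :=
  \sum_(nt.+2 <= j < (nt.+1 + ncal).+1) \1_D (block Z 1 nt w, Z j%:Z w).

(** The first [r.-1] calibration points are all counted as hits; dropping them leaves a gap of
    exactly [r] after the last training time [nt.+1]. *)
Lemma cal_hits_le (nt ncal r N : nat) (D : set (nt.+1.-tuple T * T)) w :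
  (0 < r)%N -> (r.-1 + N = ncal)%N ->
  cal_hits ncal D w <= r.-1%:R + \sum_(k < N)
    \1_D (block Z 1 nt w, Z (1 + nt%:Z + r%:Z + (k : nat)%:Z) w).
Proof.
case: r => [//|r] _ /= <-.
rewrite /cal_hits (@big_cat_nat _ _ _ (nt.+2 + r)) ?leq_addr //=; last first.
  by rewrite addSn ltnS addnA leq_addr.
apply: lerD.
  rewrite -[leRHS](_ : \sum_(nt.+2 <= j < nt.+2 + r) 1 = _).
    by apply: ler_sum => j _; rewrite indicE lern1 leq_b1.
  by rewrite sumr_const_nat addKn.
rewrite -{1}[(nt.+2 + r)%N]add0n big_addn big_mkord.
rewrite (_ : ((nt.+1 + (r + N)).+1 - (nt.+2 + r))%N = N); last first.
  by rewrite -addSn addnA addKn.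
apply: ler_sum => k _; rewrite (_ : (k + (nt.+2 + r))%N%:Z =
  1 + nt%:Z + r.+1%:Z + (k : nat)%:Z) //.
by clear; lia.
Qed.

(** After the gap [r] the training block is frozen at cost [beta r]. Its section of [D] is then a
    fixed set of probability at most [rho], to which [hits_bernstein] applies; [confidence_budget]
    adds up the failure probabilities. *)
Lemma cal_hits_bound (nt ncal a m r : nat) (D : set (nt.+1.-tuple T * T))
    (rho delta : R) :
  measurable D -> (forall u, P [set w | D (u, Z 0 w)] <= rho%:E)%E ->
  delta < 1 -> F_cal beta ncal delta (a, m, r) ->
  (P [set w | (ncal%:R * (rho + cal_term beta ncal delta (a, m, r)) <=
     cal_hits ncal D w)%R] <= delta%:E)%E.
Proof.
move=> mD Drho delta1 [a0 m0 r0 E xpos].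
pose N := (2 * m * a)%N.
have EN : (r.-1 + N = ncal)%N by rewrite /N; clear -E r0; lia.
have N0 : (0 < N)%N by rewrite !muln_gt0 m0 a0.
have ncal0 : 0 < ncal%:R :> R by rewrite ltr0n -EN ltn_addl.
rewrite (cal_term_bernstein_radius _ r0 E).
set x := delta - _ - _; set L := ln _; set eps := bernstein_radius _ _ _ _ _.
have ba : 0 <= beta a by exact: beta_coef_ge0.
have br : 0 <= beta r by exact: beta_coef_ge0.
have mR : 1 <= m%:R :> R by rewrite ler1n.
have x0 : 0 < x by rewrite /x -addrA -opprD subr_gt0.
have mba : 0 <= (m%:R - 1) * beta a by rewrite mulr_ge0 // subr_ge0.
have x1 : x < 1.
  by rewrite /x -mulrA; exact: confidence_budget_lt1.
have L0 : 0 < L.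
  by rewrite ln_gt0 // ltr_pdivlMr // mul1r (lt_trans x1) // ltr1n.
have eL : expR (- L) = x / 4.
  by rewrite expRN lnK ?invf_div // posrE divr_gt0.
have eps0 : 0 <= eps.
  rewrite /eps /bernstein_radius addr_ge0 // mulr_ge0 ?sqrtr_ge0 ?ltW //.
  by rewrite divr_gt0 // mulr_gt0 // ltr0n.
pose B := [set y : nt.+1.-tuple T * N.-1.+1.-tuple T |
  N%:R * (rho + eps) <= \sum_(k < N) \1_D (y.1, tnth y.2 (inord k))].
have mB : measurable B.
  rewrite -[X in measurable X]setTI; apply: measurable_fun_le => //.
  apply: measurable_sum => k.
  apply: (measurableT_comp (measurable_indic mD)).
  apply/measurable_fun_pairP; split; first exact: measurable_fst.
  exact: (measurableT_comp (measurable_tnth _) measurable_snd).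
have tnthE w (k : 'I_N) : tnth (block Z (1 + nt%:Z + r%:Z) N.-1 w) (inord k) =
    Z (1 + nt%:Z + r%:Z + (k : nat)%:Z) w.
  by rewrite tnth_mktuple inordK // prednK.
apply: (@le_trans _ _ (P [set w |
    B (block Z 1 nt w, block Z (1 + nt%:Z + r%:Z) N.-1 w)])).
  apply: le_measure; rewrite ?inE.
  - rewrite -[X in measurable X]setTI; apply: measurable_fun_le => //.
    apply: measurable_sum => j; apply: (measurableT_comp (measurable_indic mD)).
    by apply/measurable_fun_pairP; split; [exact: measurable_block|exact: mZ].
  - by apply: measurable_preimage_pair mB; exact: measurable_block.
  - move=> w; rewrite /B /= => H.
    under eq_bigr do rewrite tnthE.
    have := cal_hits_le D w r0 EN.
    move=> H2; have := le_trans H H2.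
    rewrite -lerBlDl; apply: le_trans.
    rewrite (_ : _ - _ = ncal%:R * (rho + eps)); last first.
      by rewrite addrA mulrDr [ncal%:R * (_ / _)]mulrC divfK ?gt_eqF // addrK.
    rewrite ler_wpM2r //; last by rewrite ler_nat -EN leq_addl.
    rewrite addr_ge0 //.
    (* Nonnegativity of [rho] is read off at an arbitrary training block. *)
    have := le_trans (measure_ge0 P _) (Drho (nseq_tuple _ (Z 0 w))).
    by rewrite lee_fin.
apply: (le_trans (mixing_decoupling mZ sZ 1 r mB)).
pose c := 2 * expR (- L) + 2 * (m%:R - 1) * beta a.
have c0 : 0 <= c.
  by rewrite /c addr_ge0 ?mulr_ge0 ?expR_ge0 // subr_ge0.
apply: (@le_trans _ _ (c%:E + (beta r)%:E)%E); last first.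
  rewrite -EFinD lee_fin /c eL; move: x0; rewrite /x -!mulrA.
  exact: confidence_budget.
rewrite leeD2r //.
rewrite -[leRHS](_ : (\int[P]_w cst c%:E w = c%:E)%E); last first.
  rewrite integral_cst // [X in (_ * X)%E](_ : _ = 1%E) ?mule1 //.
  exact: probability_setT.
apply: ge0_le_integral => //.
- by apply: measurable_fun_copy mB; exact: measurable_block.
- move=> w _; set u := block Z 1 nt w.
  have mDu : measurable [set z | D (u, z)] := measurable_section u mD.
  have /= H := hits_bernstein mZ sZ mDu m.-1 (1 + nt%:Z + r%:Z) a0 L0.
  rewrite prednK // in H.
  rewrite (_ : c = 2 * expR (- L) + 2 * m.-1%:R * beta a); last first.
    by rewrite -subn1 natrB.
  apply: le_trans H; apply: le_measure; rewrite ?inE.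
  + apply: measurable_preimage (measurable_section u mB).
    exact: measurable_block.
  + rewrite -[X in measurable X]setTI; apply: measurable_fun_le => //.
    exact: measurable_hits.
  + move=> w' /=; rewrite /B /=; under eq_bigr do rewrite tnthE.
    rewrite /hits => H.
    apply: le_trans (le_trans _ H) _.
      rewrite ler_wpM2l // lerD2r -lee_fin fineK; first exact: Drho.
      by rewrite fin_num_measure //; exact: (measurable_preimage (mZ 0) mDu).
    by apply: ler_sum => k _; exact: lexx.
Qed.
End split_conformal.

(** * Conditional ranks *)

Section rank.
Context {d dT dU : measure_display} {Om : measurableType d} {T : measurableType dT}
  {U : measurableType dU} {R : realType}.
Variables (P : probability Om R) (Y : Om -> T) (S : U * T -> R).
Hypotheses (mY : measurable_fun setT Y) (mS : measurable_fun setT S).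

(** The conditional rank is the distribution function of the score for a frozen first component,
    evaluated at the point's own score. Used with [- S] it measures the upper tail. *)
Definition rank_set (rho : R) : set (U * T) :=
  [set x | (P [set w | (S (x.1, Y w) <= S x)%R] <= rho%:E)%E].

Lemma measurable_score_section u : measurable_fun setT (fun w => S (u, Y w)).
Proof.
apply: (measurableT_comp mS); apply/measurable_fun_pairP.
by split; [exact: measurable_cst|exact: mY].
Qed.

Lemma measurable_rank_set rho : measurable (rank_set rho).
Proof.
have mB : measurable [set y : (U * T) * Om | S (y.1.1, Y y.2) <= S y.1].
  rewrite -[X in measurable X]setTI; apply: measurable_fun_le => //.
    apply: (measurableT_comp mS); apply/measurable_fun_pairP; split.
      exact: (measurableT_comp measurable_fst measurable_fst).
    exact: (measurableT_comp mY measurable_snd).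
  exact: (measurableT_comp mS measurable_fst).
rewrite -[X in measurable X]setTI /rank_set; apply: measurable_lee => //.
exact: (measurable_fun_section P mB).
Qed.

Lemma rank_set_prob rho u : 0 <= rho ->
  (P [set w | rank_set rho (u, Y w)] <= rho%:E)%E.
Proof. exact: probability_cdf_le (measurable_score_section u). Qed.
End rank.

Lemma test_point_prob d dT (Om : measurableType d) (T : measurableType dT)
    (R : realType) (P : probability Om R) (Z : int -> Om -> T)
    (nt g : nat) (G : set (nt.+1.-tuple T * T)) (rho : R) :
  (forall t, measurable_fun setT (Z t)) -> stationary P Z -> measurable G ->
  0 <= rho -> (forall u, P [set w | G (u, Z 0%R w)] <= rho%:E)%E ->
  (P [set w | G (block Z 1 nt w, Z (nt.+1 + g)%N%:Z w)] <=
    (rho + beta_coef P Z g)%:E)%E.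
Proof.
move=> mZ sZ mG rho0 Grho.
pose B := [set x : nt.+1.-tuple T * 1.-tuple T | G (x.1, tnth x.2 ord0)].
have mt : measurable_fun setT (fun v : 1.-tuple T => tnth v ord0).
  exact: measurable_tnth.
have mB : measurable B by exact: (measurable_preimage_snd mt mG).
have Zt0 t w : tnth (block Z t 0 w) ord0 = Z t w by rewrite tnth_mktuple addr0.
have := mixing_decoupling mZ sZ 1 g mB; rewrite /B /=.
under eq_set do rewrite Zt0.
rewrite (_ : 1 + nt%:Z + g%:Z = (nt.+1 + g)%N%:Z) //.
move=> /le_trans; apply; rewrite EFinD leeD2r //.
rewrite -[leRHS](_ : (\int[P]_w cst rho%:E w = rho%:E)%E); last first.
  rewrite integral_cst // [X in (_ * X)%E](_ : _ = 1%E) ?mule1 //.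
  exact: probability_setT.
under eq_integral do under eq_set do rewrite Zt0.
apply: ge0_le_integral => //.
- apply: measurable_fun_copy mG; first exact: measurable_block.
  exact: mZ.
- move=> w _.
  have mGw := measurable_section (block Z 1 nt w) mG.
  have := Grho (block Z 1 nt w); apply: le_trans.
  by rewrite le_eqVlt; apply/orP; left; apply/eqP;
    rewrite [LHS](prob_hit mZ sZ mGw) -(prob_hit mZ sZ mGw 0).
Qed.

(** * The coverage event in terms of ranks *)

Lemma exists_below_gap (R : realType) (f : nat -> R) (r : seq nat) (x : R) :
  exists2 t, t < x & forall j, j \in r -> f j < x -> f j <= t.
Proof.
elim: r => [|j r [t tx IH]]; first by exists (x - 1) => //; rewrite ltrBlDr ltrDl.
have [fjx|xfj] := ltP (f j) x.
  exists (Num.max t (f j)); first by rewrite gt_max tx.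
  move=> k; rewrite inE => /predU1P[->|kr] fkx; rewrite le_max ?lexx ?orbT //.
  by rewrite IH.
exists t => // k; rewrite inE => /predU1P[->|kr] fkx; last exact: IH.
by move: fkx; rewrite ltNge xfj.
Qed.

Section coverage.
Context {d dX dY : measure_display} {Om : measurableType d}
  {TX : measurableType dX} {TY : measurableType dY} {R : realType}.
Variables (Z : int -> Om -> (TX * TY)%type) (ntrain ncal : nat).
Variable s : (ntrain.+1).-tuple (TX * TY)%type -> R.

(** The test score exceeds the infimum exactly when some threshold strictly below it already
    collects a fraction [phi] of the calibration scores. This removes the quantile, infinite values
    included. *)
Lemma coveredP (phi : R) (i : nat) w : (0 < ncal)%N ->
  covered Z ncal s phi i w <->
  \sum_(ntrain.+1 <= j < (ntrain + ncal).+1)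
    ((s_hat Z s w (Z j%:Z w) < s_hat Z s w (Z i%:Z w))%R : nat)%:R < phi * ncal%:R.
Proof.
move=> n0; set r := index_iota _ _; set f := fun j : nat => s_hat Z s w (Z j%:Z w).
have nR : 0 < ncal%:R :> R by rewrite ltr0n.
have fracE t : (phi <= cal_frac Z ncal s w t) =
    (phi * ncal%:R <= \sum_(j <- r) ((f j <= t)%R : nat)%:R).
  by rewrite /cal_frac ler_pdivlMr.
have -> : covered Z ncal s phi i w = ((f i)%:E <= qhat Z ncal s phi w)%E.
  by rewrite /covered /conf_set /= /f -surjective_pairing.
split=> [cov|H].
- rewrite ltNge; apply/negP => H.
  (* The scores are finitely many, so one [t] below the test score lies above all scores that are
     smaller than the test score; it witnesses that the quantile is at most [t]. *)
  have [t ti ht] := exists_below_gap f r (f i).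
  move: cov; rewrite leNgt => /negP; apply.
  apply: (@le_lt_trans _ _ t%:E); last by rewrite lte_fin.
  apply: ereal_inf_lbound; exists t => //=; rewrite fracE.
  apply: (le_trans H); rewrite !big_seq; apply: ler_sum => j jr.
  by rewrite ler_nat; case: ltP => // /(ht _ jr) ->.
- apply/ereal_infP => _ [t /= + <-]; rewrite fracE lee_fin => Ht.
  rewrite leNgt; apply/negP => ti; move: H; rewrite ltNge => /negP; apply.
  apply: (le_trans Ht); apply: ler_sum => j _.
  by rewrite ler_nat; case: (leP (f j) t) => // /le_lt_trans -> .
Qed.
End coverage.

(** * Coverage *)

(** Events with a null overlap have total mass at most 1. This transfers rank information from the
    test score, through one tail, to a calibration score, through the opposite tail. *)
Lemma probability_addl_le1 d (Om : measurableType d) (R : realType)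
    (P : probability Om R) (A B : set Om) (a b : R) :
  measurable A -> measurable B -> P (A `&` B) = 0%E -> a + b = 1 ->
  (b%:E < P B)%E -> (P A <= a%:E)%E.
Proof.
move=> mA mB AB0 ab1 bB; rewrite leNgt; apply/negP => aA.
have mAB : measurable (A `\` B) by exact: measurableD.
have : (P (A `\` B) + P B <= 1)%E.
  rewrite -measureU //; last by rewrite setDE -setIA setICl setI0.
  by apply: probability_le1; exact: measurableU.
have -> : P (A `\` B) = P A.
  by rewrite [RHS](measureDI P mA mB) [X in (_ + X)%E]AB0 adde0.
rewrite leNgt => /negP; apply.
by rewrite -[ltLHS](_ : (a%:E + b%:E = 1)%E) ?lteD // -EFinD ab1.
Qed.

Section coverage_bounds.
Context {d dT : measure_display} {Om : measurableType d} {T : measurableType dT}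
  {R : realType}.
Variables (P : probability Om R) (Z : int -> Om -> T) (nt ncal g : nat).
Variable S : nt.+1.-tuple T * T -> R.
Hypothesis mZ : forall t, measurable_fun setT (Z t).
Hypothesis sZ : stationary P Z.
Hypothesis mS : measurable_fun setT S.

Local Notation beta := (beta_coef P Z).
Local Notation score w z := (S (block Z 1 nt w, z)).

Definition hits_below (w : Om) : R :=
  \sum_(nt.+2 <= j < (nt.+1 + ncal).+1)
    ((score w (Z j%:Z w) < score w (Z (nt.+1 + g)%N%:Z w))%R : nat)%:R.

Let mscore j : measurable_fun setT (fun w => score w (Z j w)).
Proof.
apply: (measurableT_comp mS); apply/measurable_fun_pairP.
by split; [exact: measurable_block|exact: mZ].
Qed.

Lemma measurable_hits_below : measurable_fun setT hits_below.
Proof.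
apply: measurable_sum => j.
pose E := [set w | score w (Z j%:Z w) < score w (Z (nt.+1 + g)%N%:Z w)].
have mE : measurable E.
  rewrite (_ : E = ~` [set w | score w (Z (nt.+1 + g)%N%:Z w) <= score w (Z j%:Z w)]).
    apply: measurableC; rewrite -[X in measurable X]setTI.
    exact: measurable_fun_le.
  by apply/seteqP; split=> w /=; rewrite /E /= ltNge => /negP.
rewrite (_ : (fun w => _) = \1_E); first exact: measurable_indic.
by apply/funext => w; rewrite indicE; congr (nat_of_bool _)%:R; rewrite -[RHS]/(`[< _ >]) asboolb.
Qed.

Let mcal_hits (D : set (nt.+1.-tuple T * T)) : measurable D ->
  measurable_fun setT (cal_hits Z ncal D : Om -> R).
Proof.
move=> mD; apply: measurable_sum => j; apply: (measurableT_comp (measurable_indic mD)).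
by apply/measurable_fun_pairP; split; [exact: measurable_block|exact: mZ].
Qed.

Let mle (f : Om -> R) c : measurable_fun setT f -> measurable [set w | c <= f w].
Proof.
by move=> mf; rewrite -[X in measurable X]setTI; exact: measurable_fun_le.
Qed.

(** If the test point avoids [G], its upper tail has mass above [1 - psi]. The lower tail of any
    strictly smaller calibration score is disjoint from it, so that point lies in [D]. Non-coverage
    then puts [ncal * (psi + e)] calibration points in [D]. *)
Lemma uncovered_prob (phi delta : R) amr : phi <= 1 -> 0 < delta < 1 ->
  F_cal beta ncal delta amr ->
  (P [set w | (phi * ncal%:R <= hits_below w)%R] <=
   (delta + (1 - (phi - cal_term beta ncal delta amr) + beta g))%:E)%E.
Proof.
move=> phi1 /andP[delta0 delta1]; case: amr => -[a m] r F.
have e0 := cal_term_ge0 mZ delta1 F.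
set e := cal_term _ _ _ _ in e0 *; set psi := phi - e.
have bg0 := beta_coef_ge0 P mZ g.
have psi1 : 0 <= 1 - psi by rewrite /psi; lra.
(* A negative [psi] is no admissible rank level, but then the claimed bound exceeds 1. *)
have [psi0|psi0] := ltP psi 0.
  apply: (@le_trans _ _ 1%E).
    by apply: probability_le1; apply: mle; exact: measurable_hits_below.
  by rewrite lee_fin; lra.
pose D := rank_set P (Z 0) S psi.
pose G := rank_set P (Z 0) (fun x => - S x) (1 - psi).
have mNS : measurable_fun setT (fun x => - S x) by exact: measurable_funN.
have mD : measurable D by exact: measurable_rank_set.
have mG : measurable G by exact: measurable_rank_set.
have Dpsi u : (P [set w | D (u, Z 0 w)] <= psi%:E)%E by exact: rank_set_prob.
have Gpsi u : (P [set w | G (u, Z 0 w)] <= (1 - psi)%:E)%E by exact: rank_set_prob.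
have bad := cal_hits_bound mZ sZ mD Dpsi delta1 F.
have test := test_point_prob g mZ sZ mG psi1 Gpsi.
have mbad := mle (ncal%:R * (psi + e)) (mcal_hits mD).
have mtest : measurable [set w | G (block Z 1 nt w, Z (nt.+1 + g)%N%:Z w)].
  by apply: measurable_preimage_pair mG; [exact: measurable_block|exact: mZ].
apply: (@le_trans _ _ (P ([set w | ncal%:R * (psi + e) <= cal_hits Z ncal D w] `|`
   [set w | G (block Z 1 nt w, Z (nt.+1 + g)%N%:Z w)]))); last first.
  apply: (le_trans (measureU2 P mbad mtest)).
  by rewrite EFinD; apply: leeD.
apply: le_measure; rewrite ?inE.
- by apply: mle; exact: measurable_hits_below.
- exact: measurableU.
move=> w /= H; have [Gw|nGw] := pselect (G (block Z 1 nt w, Z (nt.+1 + g)%N%:Z w)).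
  by right.
left; rewrite /psi subrK mulrC; apply: (le_trans H).
apply: ler_sum => j _; rewrite indicE ler_nat.
case: ltP => //= sj; rewrite lt0b; apply/mem_set.
move: nGw => /= /negP; rewrite -ltNge => nGw.
apply: (probability_addl_le1 _ _ _ _ nGw); last by rewrite addrC subrK.
- by rewrite -[X in measurable X]setTI; apply: measurable_fun_le => //;
    exact: measurable_score_section.
- by rewrite -[X in measurable X]setTI; apply: measurable_fun_le => //;
    exact: (measurable_score_section (mZ 0) mNS).
- rewrite (_ : _ `&` _ = set0) ?measure0 // -subset0 => w' /= [h1].
  by rewrite lerN2 leNgt (le_lt_trans h1 sj).
Qed.

(** The mirror image with the tails exchanged. Calibration scores may now equal the test score, so
    the two tails can meet in a level set of the score, which is null by continuity outside the
    exceptional set [N] of training data. *)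
Lemma covered_prob (phi delta : R) amr : 0 <= phi -> 0 < delta < 1 ->
  F_cal beta ncal delta amr ->
  {ae P, forall w, forall t, P [set w' | score w (Z 0 w') = t] = 0%E} ->
  (P [set w | (hits_below w < phi * ncal%:R)%R] <=
   (delta + (phi + cal_term beta ncal delta amr + beta g))%:E)%E.
Proof.
move=> phi0 /andP[delta0 delta1]; case: amr => -[a m] r F cont.
have e0 := cal_term_ge0 mZ delta1 F.
set e := cal_term _ _ _ _ in e0 *; set psi := phi + e.
have bg0 := beta_coef_ge0 P mZ g.
have psi0 : 0 <= psi by rewrite /psi; lra.
have mcov : measurable [set w | hits_below w < phi * ncal%:R].
  rewrite (_ : [set w | _] = ~` [set w | phi * ncal%:R <= hits_below w]).
    by apply: measurableC; apply: mle; exact: measurable_hits_below.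
  by apply/seteqP; split=> w /=; rewrite ltNge => /negP.
have [psi1|psi1] := ltP 1 psi.
  apply: (@le_trans _ _ 1%E); first exact: probability_le1.
  by rewrite lee_fin; lra.
pose D := rank_set P (Z 0) (fun x => - S x) (1 - psi).
pose G := rank_set P (Z 0) S psi.
have mNS : measurable_fun setT (fun x => - S x) by exact: measurable_funN.
have mD : measurable D by exact: measurable_rank_set.
have mG : measurable G by exact: measurable_rank_set.
have Dpsi u : (P [set w | D (u, Z 0 w)] <= (1 - psi)%:E)%E.
  by apply: rank_set_prob; rewrite // subr_ge0.
have Gpsi u : (P [set w | G (u, Z 0 w)] <= psi%:E)%E by exact: rank_set_prob.
have bad := cal_hits_bound mZ sZ mD Dpsi delta1 F.
have test := test_point_prob g mZ sZ mG psi0 Gpsi.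
have mbad := mle (ncal%:R * (1 - psi + e)) (mcal_hits mD).
have mtest : measurable [set w | G (block Z 1 nt w, Z (nt.+1 + g)%N%:Z w)].
  by apply: measurable_preimage_pair mG; [exact: measurable_block|exact: mZ].
have [N [mN N0 contN]] := cont.
set E1 := [set w | _ <= _] in mbad; set E2 := [set w | G _] in mtest.
apply: (@le_trans _ _ (P ((E1 `|` E2) `|` N))); last first.
  have mE := measurableU _ _ mbad mtest.
  apply: (le_trans (measureU2 P mE mN)).
  rewrite [X in (_ + X)%E]N0 adde0; apply: (le_trans (measureU2 P mbad mtest)).
  by rewrite EFinD; apply: leeD.
apply: le_measure; rewrite ?inE //.
  by apply: measurableU => //; exact: measurableU.
move=> w /= H; have [Nw|nNw] := pselect (N w); first by right.
have cw t : P [set w' | score w (Z 0 w') = t] = 0%E.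
  by apply: contrapT => h; apply: nNw; apply: contN => /= /(_ t).
left; have [Gw|nGw] := pselect (E2 w); first by right.
left; rewrite /E1 /= (_ : 1 - psi + e = 1 - phi); last by rewrite /psi; ring.
have sum_ge : (1 - phi) * ncal%:R <=
    \sum_(nt.+2 <= j < (nt.+1 + ncal).+1)
    ((score w (Z (nt.+1 + g)%N%:Z w) <= score w (Z j%:Z w))%R : nat)%:R.
  have : hits_below w + \sum_(nt.+2 <= j < (nt.+1 + ncal).+1)
      ((score w (Z (nt.+1 + g)%N%:Z w) <= score w (Z j%:Z w))%R : nat)%:R = ncal%:R.
    rewrite -big_split /= (eq_bigr (fun=> 1)); last first.
      by move=> j _; rewrite leNgt; case: (_ < _); rewrite ?addr0 ?add0r.
    by rewrite sumr_const_nat subSS addKn.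
  by move: H; rewrite mulrBl mul1r; move: (hits_below w) (\sum_(_ <= _ < _) _) (phi * _) => *; lra.
rewrite mulrC; apply: (le_trans sum_ge).
apply: ler_sum => j _; rewrite indicE ler_nat.
case: leP => //= sj; rewrite lt0b; apply/mem_set.
move: nGw => /= /negP; rewrite -ltNge => nGw.
apply: (probability_addl_le1 _ _ _ _ nGw); last by rewrite subrK.
- by rewrite -[X in measurable X]setTI; apply: measurable_fun_le => //;
    exact: (measurable_score_section (mZ 0) mNS).
- by rewrite -[X in measurable X]setTI; apply: measurable_fun_le => //;
    exact: measurable_score_section.
(* A score at least [s_j] and at most the test score, with the test score at most [s_j], equals the
   test score. *)
- apply/eqP; rewrite eq_le measure_ge0 andbT -[leRHS](cw (score w (Z (nt.+1 + g)%N%:Z w))).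
  have mX := measurable_score_section (mZ 0) mS (block Z 1 nt w).
  apply: le_measure; rewrite ?inE.
  + apply: measurableI; rewrite -[X in measurable X]setTI; apply: measurable_fun_le => //.
    exact: (measurable_score_section (mZ 0) mNS).
  + by rewrite -[X in measurable X]setTI; exact: mX (measurable_set1 _).
  + move=> w' /= []; rewrite lerN2 => h1 h2; apply/eqP.
    by rewrite eq_le h2 (le_trans sj h1).
Qed.
End coverage_bounds.

(** * From each admissible triple to the infimum, and the coverage bounds *)

Lemma eps_cal_addr_ge (R : realType) (beta : nat -> R) (ncal : nat) (delta b c : R) :
  (forall amr, F_cal beta ncal delta amr -> c <= cal_term beta ncal delta amr + b) ->
  (c%:E <= eps_cal beta ncal delta + b%:E)%E.
Proof.
move=> H; rewrite -leeBlDr // -EFinB; apply/ereal_infP => _ [amr Famr <-].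
by rewrite lee_fin lerBlDr; exact: H.
Qed.

Theorem theorem3p1 (R : realType) (d dX dY : measure_display)
  (Om : measurableType d) (TX : measurableType dX) (TY : measurableType dY)
  (P : probability Om R) (Z : int -> Om -> (TX * TY)%type) (Zstar : Om -> (TX * TY)%type)
  (ntrain ncal ntest : nat) (s : (ntrain.+1).-tuple (TX * TY)%type -> R)
  (alpha delta : R) :
  (forall t : int, measurable_fun [set: Om] (Z t)) ->
  stationary P Z ->
  beta_mixing P Z ->
  measurable_fun [set: Om] Zstar ->
  (forall A : set (TX * TY)%type, measurable A ->
     P (Zstar @^-1` A) = P (Z 1 @^-1` A)) ->
  (forall (A : set (TX * TY)%type) (B : set ((ntrain + ncal + ntest).-tuple (TX * TY)%type)),
     measurable A -> measurable B ->
     P (Zstar @^-1` A `&` (fun w => [tuple Z ((j : nat).+1)%:Z w | j < ntrain + ncal + ntest]) @^-1` B)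
     = (P (Zstar @^-1` A) * P ((fun w => [tuple Z ((j : nat).+1)%:Z w | j < ntrain + ncal + ntest]) @^-1` B))%E) ->
  (0 < ntrain)%N -> (0 < ncal)%N -> (0 < ntest)%N ->
  measurable_fun [set: (ntrain.+1).-tuple (TX * TY)%type] s ->
  0 < alpha < 1 -> 0 < delta ->
  forall i : nat, (ntrain + ncal < i <= ntrain + ncal + ntest)%N ->
  let beta := beta_coef P Z in
  let eta := (eps_cal beta ncal delta + (beta (i - ntrain)%N)%:E + delta%:E)%E in
  ((1 - alpha)%:E - eta <= P (covered Z ncal s (1 - alpha) i))%E /\
  ({ae P, forall w, forall t : R, P [set w' | s_hat Z s w (Zstar w') = t] = 0%E} ->
   (`| P (covered Z ncal s (1 - alpha) i) - (1 - alpha)%:E | <= eta)%E).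
Proof.
move=> mZ sZ _ mZstar lawZstar _ + ncal0 _ ms /andP[alpha0 alpha1] delta0 i.
case: ntrain s ms => // nt s ms _ /andP[iN _] beta eta.
set phi := 1 - alpha.
have phi1 : phi <= 1 by rewrite gerBl ltW.
have phi0 : 0 <= phi by rewrite subr_ge0 ltW.
clearbody phi.
pose T : measurableType _ := (TX * TY)%type.
have [g iE] : exists g, i = (nt.+1 + g)%N.
  exists (i - nt.+1)%N; rewrite subnKC // ltnW // (leq_ltn_trans _ iN) //.
  exact: leq_addr.
(* The trained score as a function of the training block and the point separately, so that
   decoupling can freeze the former. *)
pose S (x : nt.+1.-tuple T * T) : R :=
  s [tuple (if (k < nt.+1)%N then tnth x.1 (inord k) else x.2) | k < nt.+2].
have mS : measurable_fun setT S.
  apply: (measurableT_comp ms); apply/measurable_fun_tnthP => k.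
  rewrite (_ : _ \o _ = fun x : nt.+1.-tuple T * T =>
    if (k < nt.+1)%N then tnth x.1 (inord k) else x.2); last first.
    by apply/funext => x /=; rewrite tnth_mktuple.
  case: (k < nt.+1)%N; last exact: measurable_snd.
  exact: (measurableT_comp (measurable_tnth (inord k)) measurable_fst).
have SE w z : s_hat Z s w z = S (block Z 1 nt w, z).
  congr (s _); apply/eq_from_tnth => k; rewrite !tnth_mktuple.
  by case: ifP => // kn; rewrite inordK.
have belowE w : \sum_(nt.+2 <= j < (nt.+1 + ncal).+1)
    ((s_hat Z s w (Z j%:Z w) < s_hat Z s w (Z i%:Z w))%R : nat)%:R =
    hits_below Z ncal g S w.
  by apply: eq_bigr => j _; rewrite !SE iE.
have covE : covered Z ncal s phi i =
    [set w | hits_below Z ncal g S w < phi * ncal%:R].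
  apply/seteqP; split=> w /=; last by move=> h; apply/coveredP => //; rewrite belowE.
  by move=> /(coveredP _ _ _ _ _ ncal0); rewrite belowE.
have gE : (i - nt.+1 = g)%N by rewrite iE addKn.
have mge : measurable [set w | phi * ncal%:R <= hits_below Z ncal g S w].
  rewrite -[X in measurable X]setTI; apply: measurable_fun_le => //.
  exact: measurable_hits_below.
have covC : [set w | hits_below Z ncal g S w < phi * ncal%:R] =
    ~` [set w | phi * ncal%:R <= hits_below Z ncal g S w].
  by apply/seteqP; split=> w /=; rewrite ltNge => /negP.
have mcov : measurable (covered Z ncal s phi i).
  by rewrite covE covC; exact: measurableC.
have bg0 : 0 <= beta g by exact: beta_coef_ge0.
set c := fine (P (covered Z ncal s phi i)).
have cE : P (covered Z ncal s phi i) = c%:E by rewrite fineK // fin_num_measure.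
have c01 : 0 <= c <= 1.
  by rewrite -!lee_fin -cE measure_ge0 probability_le1.
have /andP[c0 c1] := c01.
have lower : forall amr, F_cal beta ncal delta amr ->
    phi - c <= cal_term beta ncal delta amr + (beta g + delta).
  (* For [delta >= 1] the right side is at least 1, which already bounds [phi - c]. *)
  move=> amr F; have [delta1|delta1] := ltP delta 1; last first.
    case: amr F => -[a m] r F; have := cal_term_addl_ge1 mZ delta1 F.
    by rewrite -/beta => h; move: (cal_term _ _ _ _) h => x h; lra.
  have delta01 : 0 < delta < 1 by rewrite delta0.
  have := uncovered_prob g mZ sZ mS phi1 delta01 F.
  have -> : P [set w | (phi * ncal%:R <= hits_below Z ncal g S w)%R] = (1 - c)%:E.
    rewrite EFinB -cE -probability_setC //; congr (P _).
    by rewrite covE covC setCK.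
  rewrite lee_fin -/beta => h; move: (cal_term _ _ _ _) h => x h; lra.
have b_eta : eta = (eps_cal beta ncal delta + (beta g + delta)%:E)%E.
  by rewrite /eta gE EFinD addeA.
split.
  have := eps_cal_addr_ge lower; rewrite -b_eta cE.
  (* If [F_cal] is empty then [eta] is [+oo] and the lower bound is [-oo]. *)
  case: eta {b_eta} => [e| |] //=; rewrite -?EFinB ?lee_fin ?leNye //.
  by move=> h; lra.
move=> cont.
(* For a frozen training block the level set is a fixed measurable set, and [Zstar], [Z 1] and [Z 0]
   give it the same mass. *)
have cont' : {ae P, forall w, forall t, P [set w' | S (block Z 1 nt w, Z 0 w') = t] = 0%E}.
  apply: filterS cont => w h t; have := h t.
  have mt : measurable [set z | S (block Z 1 nt w, z) = t].
    have mSw : measurable_fun setT (fun z => S (block Z 1 nt w, z)).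
      apply: (measurableT_comp mS); apply/measurable_fun_pairP.
      by split; [exact: measurable_cst|exact: measurable_id].
    rewrite -[X in measurable X]setTI; exact: mSw (measurable_set1 t).
  under eq_set do rewrite SE.
  have -> := lawZstar _ mt.
  by rewrite [LHS](prob_hit mZ sZ mt) -(prob_hit mZ sZ mt 0).
have upper : forall amr, F_cal beta ncal delta amr ->
    `|c - phi| <= cal_term beta ncal delta amr + (beta g + delta).
  move=> amr F; have := lower amr F.
  have [delta1|delta1] := ltP delta 1; last first.
    case: amr F => -[a m] r F; have := cal_term_addl_ge1 mZ delta1 F.
    rewrite -/beta => h _; rewrite ler_norml; move: (cal_term _ _ _ _) h => x h; lra.
  have delta01 : 0 < delta < 1 by rewrite delta0.
  have := covered_prob g mZ sZ mS phi0 delta01 F cont'.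
  rewrite -covE cE lee_fin -/beta ler_norml.
  move: (cal_term _ _ _ _) => x h1 h2; lra.
by have := eps_cal_addr_ge upper; rewrite -b_eta cE -EFinB.
Qed.
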